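(* Let $N=n+d$. The top homology of $T''_{d,n}$ is $\mathbb Z^h$, where $h$ is the number of sequences $(m_1,\dots,m_{N-2})$ that are orderings of $\{2,\dots,N-1\}$ such that $m_1$ is unmarked, $m_{N-2}$ is marked, and whenever $m_l$ and $m_{l+1}$ are both marked or both unmarked we have $m_l<m_{l+1}$. (Equivalently, $h$ is the number of combs with leaf sequence $1,m_1,\dots,m_{N-2},N$ in which the neighbour of $1$ is unmarked, the neighbour of $N$ is marked, and any two consecutive ends either have different colors or have the same color with increasing labels.)
   Context: $\mathbb{TP}^{d-1}=\mathbb R^d/\mathbb R(1,\dots,1)$. $T_{d,n}$ is the space of $n$-tuples of points of $\mathbb{TP}^{d-1}$ lying on a common tropical line (one-dimensional polyhedral complex, combinatorially a tree, unbounded edges in directions $e_1,\dots,e_d$, balanced at each vertex); $T'_{d,n}$ is its quotient by simultaneous translation and $T''_{d,n}$ the intersection of $T'_{d,n}$ with a unit sphere about the origin. Labels $1,\dots,n\in[N]$ are marked and $n+1,\dots,n+d$ unmarked (this is the ''color'' of a label). $T''_{d,n}$ carries the simplicial structure whose vertices are the bicolored splits of $[N]$ (partitions $A|B$ with both parts of size $\ge2$ and each containing a marked and an unmarked label) and whose faces are sets of pairwise compatible bicolored splits ($A|A'$, $B|B'$ compatible if one of $A\cap B,A\cap B',A'\cap B,A'\cap B'$ is empty). A comb with leaf sequence $1,m_1,\dots,m_{N-2},N$ is the trivalent tree whose internal edges induce the splits $\{m_l,\dots,m_{N-2},N\}\,|\,\text{complement}$ for $l=2,\dots,N-2$. *)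

(* Defs.v *)
From HB Require Import structures.
From mathcomp Require Import all_boot all_order all_algebra.
From mathcomp Require Import boolp.

Set Implicit Arguments.
Unset Strict Implicit.
Unset Printing Implicit Defensive.

Import GRing.Theory.
Local Open Scope ring_scope.

(* Reduced simplicial homology with integer coefficients of an abstract
   simplicial complex K, given as the set of its faces (the empty face
   included).  Everything is graded by the number k of vertices of a face, that
   is, by dimension plus one: [homology K k] is the reduced group H_(k-1)(K; Z).
   A chain is the function giving its coefficients on the faces, each face
   being oriented by the enumeration order of V. *)
Section SimplicialHomology.
Variable V : finType.
Implicit Types (K : {set {set V}}) (k : nat) (F : {set V}).
Implicit Types c : {ffun {set V} -> int}.

Definition is_chain K k c : bool :=
  [forall F, (c F != 0) ==> (F \in K) && (#|F| == k)].

(* The position of v in the face v |: F. *)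
Definition face_index F (v : V) : nat :=
  #|[set w in F | (enum_rank w < enum_rank v)%N]|.

(* The coefficient of F in the boundary of c: a face v |: F contributes
   (-1)^i times its own coefficient, i being the position of v in it. *)
Definition boundary c : {ffun {set V} -> int} :=
  [ffun F : {set V} => \sum_(v | v \notin F) (-1) ^+ face_index F v * c (v |: F)].

Definition cycle_pred K k : pred {ffun {set V} -> int} :=
  fun c => is_chain K k c && (boundary c == 0).

Lemma is_chain_zmod K k : zmod_closed (is_chain K k).
Proof.
split=> [|c1 c2 /forallP h1 /forallP h2].
  by apply/forallP=> F; rewrite ffunE eqxx.
apply/forallP=> F; rewrite !ffunE; apply/implyP=> nz.
have := h1 F; have := h2 F.
have [e1|_ _ /= -> //] := eqVneq (c1 F) 0.
have [e2|_ /= -> //] := eqVneq (c2 F) 0.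
by rewrite e1 e2 subrr eqxx in nz.
Qed.

Lemma boundaryB c1 c2 : boundary (c1 - c2) = boundary c1 - boundary c2.
Proof.
apply/ffunP=> F; rewrite !ffunE -sumrB; apply: eq_bigr => v _.
by rewrite !ffunE mulrBr.
Qed.

Lemma boundary0 : boundary 0 = 0.
Proof. by rewrite -[0 in LHS](subrr 0) boundaryB subrr. Qed.

Lemma cycle_pred_zmod K k : zmod_closed (cycle_pred K k).
Proof.
have [c0 cB] := is_chain_zmod K k.
split=> [|x y /andP[cx /eqP bx] /andP[cy /eqP by0]].
  by apply/andP; split; [exact: c0 | rewrite boundary0].
by apply/andP; split; [exact: cB | rewrite boundaryB bx by0 subrr].
Qed.

HB.instance Definition _ K k :=
  GRing.isZmodClosed.Build {ffun {set V} -> int} (cycle_pred K k)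
    (cycle_pred_zmod K k).

Record cycles K k := Cycle {
  cycle_val :> {ffun {set V} -> int};
  _ : cycle_pred K k cycle_val }.

HB.instance Definition _ K k := [isSub for @cycle_val K k].
HB.instance Definition _ K k := [Choice of cycles K k by <:].
HB.instance Definition _ K k := [SubChoice_isSubZmodule of cycles K k by <:].

Definition boundary_pred K k : pred (cycles K k) :=
  fun z => `[< exists2 c, is_chain K k.+1 c & boundary c = z >].

Lemma boundary_pred_zmod K k : zmod_closed (@boundary_pred K k).
Proof.
have [c0 cB] := is_chain_zmod K k.+1.
split=> [|x y /asboolP[c1 h1 e1] /asboolP[c2 h2 e2]]; apply/asboolP.
  by exists 0; [exact: c0 | rewrite boundary0].
by exists (c1 - c2); [exact: cB | rewrite boundaryB e1 e2].
Qed.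

HB.instance Definition _ K k :=
  GRing.isZmodClosed.Build (cycles K k) (@boundary_pred K k)
    (boundary_pred_zmod K k).

Definition boundaries K k : zmodClosed (cycles K k) :=
  GRing.ZmodClosed.clone (cycles K k) (@boundary_pred K k) _.

Definition homology K k : zmodType := Quotient.quot (boundaries K k).

Definition top_homology K : zmodType := homology K (\max_(F in K) #|F|).

End SimplicialHomology.

Local Open Scope nat_scope.

(* Labels are the numbers 1, ..., n + d; the element i : 'I_(n + d) stands for
   the label i.+1. *)
Definition marked (n : nat) (a : nat) : bool := 0 < a <= n.

Definition label N (i : 'I_N) : nat := i.+1.

(* A split A|B is the two-block set partition [set A; B]. *)
Definition bicolored_split n d (P : {set {set 'I_(n + d)}}) : bool :=
  [&& partition P [set: 'I_(n + d)], #|P| == 2 &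
      [forall A in P,
         [&& 2 <= #|A|, [exists i in A, marked n (label i)]
           & [exists i in A, ~~ marked n (label i)]]]].

Definition compatible N (P Q : {set {set 'I_N}}) : bool :=
  [exists A in P, exists B in Q, A :&: B == set0].

(* T''_(d,n) is taken with its simplicial structure, whose faces are the sets
   of pairwise compatible bicolored splits. *)
Definition T'' d n : {set {set {set {set 'I_(n + d)}}}} :=
  [set F : {set {set {set 'I_(n + d)}}} |
     [forall P in F, @bicolored_split n d P] &&
     [forall P in F, forall Q in F, compatible P Q]].

Definition color_increasing n : rel nat :=
  fun a b => (marked n a == marked n b) ==> (a < b).

Definition admissible n (m : seq nat) : bool :=
  [&& ~~ marked n (head 0 m), marked n (last 0 m)
    & sorted (color_increasing n) m].

(* iota 2 (n + d - 2) lists 2, ..., n + d - 1, and permutations is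
   duplicate-free. *)
Definition inner_orderings d n : seq (seq nat) :=
  permutations (iota 2 (n + d - 2)).

Definition num_orderings d n : nat := count (admissible n) (inner_orderings d n).

(* The split {m_l, ..., m_(N-2), N} | complement, where m = (m_1, ..., m_(N-2)). *)
Definition tail_split N (m : seq nat) (l : nat) : {set {set 'I_N}} :=
  let A := [set i : 'I_N | label i \in rcons (drop l.-1 m) N] in [set A; ~: A].

(* A tree is represented by the set of splits induced by its internal edges;
   here l runs through 2, ..., N - 2. *)
Definition comb N (m : seq nat) : {set {set {set 'I_N}}} :=
  [set:: [seq tail_split N m l | l <- iota 2 (N - 3)]].

(* The condition on the whole leaf sequence s = 1, m_1, ..., m_(N-2), N. *)
Definition admissible_leaves n (s : seq nat) : bool :=
  [&& ~~ marked n (nth 0 s 1), marked n (nth 0 s (size s - 2))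
    & sorted (color_increasing n) s].

Definition admissible_combs d n : {set {set {set {set 'I_(n + d)}}}} :=
  [set:: [seq comb (n + d) m | m <- inner_orderings d n
                             & admissible_leaves n (1 :: rcons m (n + d))]].

(* Main.v *)
Require Import Defs.
From HB Require Import structures.
From mathcomp Require Import all_boot all_order all_algebra.
From mathcomp Require Import fingroup perm generic_quotient ring_quotient boolp.
From mathcomp Require Import zify.

(* Let z be the last leaf and o the first one. Identifying a split with its block
   avoiding z, a face becomes a laminar family; faces have at most N - 3 elements,
   so the top homology is the group of cycles supported on the faces with N - 3
   elements. The map sending a cycle to its values at the admissible combs is
   bijective.

   Injectivity: removing a split from a maximal face leaves a vertex with three
   children, hence at most two other completions. Such flips lead from any
   maximal face to faces all of whose blocks contain o, that is to combs, and
   flips between combs sort the leaves of equal color, because the third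
   completion is monochromatic.

   Surjectivity: to a word w of leaves starting with o attach the linear
   functionals A |-> [w_j, w_(j+1) in A] - [w_(j+1), w_(j+2) in A] on blocks. The
   determinant of these functionals on a maximal face is a cycle of the complex of
   all splits: the three completions AB, AC, BC satisfy
   r(AB) + r(AC) + r(BC) = r(ABC) + r(A) + r(B) + r(C).
   On the comb of a word w' it is +-1 if w = w' and 0 otherwise. For an
   admissible m, the signed sum of these cycles over the words obtained from m by
   permuting letters inside the monochromatic runs vanishes on every face with a
   monochromatic block, so it is a cycle of the complex of bicolored splits. *)

Set Implicit Arguments.
Unset Strict Implicit.
Unset Printing Implicit Defensive.

Import GRing.Theory.

(** * Laminar families *)

Section Laminar.
Variable L : finType.
Implicit Types (A B C X Y S u v : {set L}) (G : {set {set L}}).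

Definition nested X Y := [|| X \subset Y, Y \subset X | [disjoint X & Y]].

Definition laminar_in S G :=
  {in G, forall X, (X \subset S) && (1 < #|X|)} /\ {in G &, forall X Y, nested X Y}.

Lemma nestedC X Y : nested X Y = nested Y X.
Proof. by rewrite /nested disjoint_sym orbCA. Qed.

Lemma nested_meet X Y x : nested X Y -> x \in X -> x \in Y -> X \subset Y \/ Y \subset X.
Proof.
case/or3P=> [|| dXY xX xY]; [by left | by right |].
by rewrite (disjointFr dXY xX) in xY.
Qed.

Lemma nested1 x Y : nested [set x] Y.
Proof.
rewrite /nested sub1set; have [//|xY] := boolP (x \in Y).
by rewrite disjoints1 xY orbT.
Qed.

Lemma laminar_bound S G : laminar_in S G -> #|G| <= #|S|.-1.
Proof.
move: {2}#|S| (leqnn #|S|) => s; elim: s S G => [|s IHs] S G leS [sG nG].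
  have [-> | [X XG]] := set_0Vmem G; first by rewrite cards0.
  by have /andP[/subset_leq_card] := sG X XG; lia.
have [-> | [X0 X0G]] := set_0Vmem G; first by rewrite cards0.
case: (arg_minnP (fun X : {set L} => #|X|) X0G) => B BG minB.
have {}BG : B \in G by [].
have minB' X a : X \in G -> a \in B -> a \in X -> B \subset X.
  move=> XG aB aX; case: (nested_meet (nG _ _ BG XG) aB aX) => // sXB.
  by have -> : X = B by apply/eqP; rewrite eqEcard sXB minB.
have /andP[sBS B_gt1] := sG B BG.
have /card_gt0P[a aB] : 0 < #|B| by apply: ltnW.
have /card_gt0P[b] : 0 < #|B :\ a| by move: B_gt1; rewrite (cardsD1 a B) aB.
rewrite !inE => /andP[ba bB].
have aS : a \in S := subsetP sBS a aB.
have injf : {in G :\ B &, injective (fun X => X :\ a)}.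
  have aux X Y : X \in G -> Y \in G -> X :\ a = Y :\ a -> a \in Y -> a \in X.
    move=> XG YG e aY; apply: (subsetP _ _ aB).
    apply: (minB' X b) => //.
    have : b \in Y :\ a by rewrite !inE ba (subsetP (minB' Y a YG aB aY)).
    by rewrite -e !inE ba.
  move=> X Y /setD1P[_ XG] /setD1P[_ YG] e.
  have eqa : (a \in X) = (a \in Y).
    by apply/idP/idP => H; [apply: (aux Y X) | apply: (aux X Y)].
  apply/setP=> x; have [->//|xa] := eqVneq x a.
  by have /setP/(_ x) := e; rewrite !inE xa.
have := IHs (S :\ a) [set X :\ a | X in G :\ B].
have := cardsD1 a S; rewrite aS => cS.
have := cardsD1 B G; rewrite BG => cG.
rewrite card_in_imset //= => H.
suff : #|G :\ B| <= #|S :\ a|.-1.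
  have : 0 < #|S :\ a| by apply/card_gt0P; exists b; rewrite !inE ba (subsetP sBS).
  by rewrite cS cG !add1n /=; case: #|S :\ a|.
apply: H; first by move: leS; rewrite cS add1n ltnS.
split.
  move=> _ /imsetP[X /setD1P[XB XG] ->].
  have /andP[XS X_gt1] := sG X XG.
  rewrite setSD //=.
  have := cardsD1 a X; have [aX|] := boolP (a \in X); last by rewrite add0n => _ <-.
  have sBX := minB' X a XG aB aX.
  have : #|B| < #|X|.
    by apply: proper_card; rewrite properEneq eq_sym XB.
  by move=> lt; rewrite add1n => e; rewrite -ltnS -e (leq_ltn_trans B_gt1 lt).
move=> _ _ /imsetP[X /setD1P[_ XG] ->] /imsetP[Y /setD1P[_ YG] ->].
case/or3P: (nG X Y XG YG) => [h|h|h]; apply/or3P.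
- by apply: Or31; exact: setSD.
- by apply: Or32; exact: setSD.
- apply: Or33; apply: disjointWl (subsetDl _ _) _.
  exact: disjointWr (subsetDl _ _) h.
Qed.

Definition node G X := (X \in G) || (#|X| == 1).

Section Maximal.
Variables (S : {set L}) (G : {set {set L}}).
Hypotheses (lamG : laminar_in S G) (cardG : #|G| = #|S|.-1).

Lemma maximal_mem X : X \subset S -> 1 < #|X| -> {in G, forall Y, nested X Y} -> X \in G.
Proof.
move=> sXS X_gt1 nX; apply: contraT => XG.
have [sG nG] := lamG.
have : laminar_in S (X |: G).
  split=> [Y /setU1P[->|/sG//]|Y Z /setU1P[->|YG] /setU1P[->|ZG]].
  - by rewrite sXS.
  - by rewrite /nested subxx.
  - exact: nX.
  - by rewrite nestedC; apply: nX.
  - exact: nG.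
move/laminar_bound; rewrite cardsU1 XG cardG; lia.
Qed.

Lemma node_nested X Y : node G X -> Y \in G -> nested X Y.
Proof.
case/orP=> [XG YG | /cards1P[x ->] _]; [exact: lamG.2 | exact: nested1].
Qed.

Lemma node_gt0 X : node G X -> 0 < #|X|.
Proof. by case/orP=> [/(lamG.1)/andP[_ /ltnW] | /eqP->]. Qed.

Lemma node_compl X B : X \in G -> B \proper X -> node G B ->
  {in G, forall Y, B \proper Y -> Y \proper X -> False} -> node G (X :\: B).
Proof.
move=> XG pBX nB noY; rewrite /node orbC.
have sBX := proper_sub pBX.
have /andP[sXS _] := lamG.1 X XG.
have := proper_card pBX; have := cardsDS sBX.
have [//|ne1] := eqVneq; rewrite /= => cD lt.
apply: maximal_mem; [exact: subset_trans (subsetDl _ _) sXS | by lia |].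
move=> Y YG; case/or3P: (lamG.2 X Y XG YG) => [h|h|h].
- by rewrite /nested (subset_trans (subsetDl _ _) h).
- case/or3P: (node_nested nB YG) => [h'|h'|h'].
  + have [e|YX] := eqVneq Y X; first by rewrite /nested e subsetDl.
    have [e|BY] := eqVneq B Y.
      by rewrite /nested e disjoint_sym disjoints_subset setCD subsetUr !orbT.
    by case: (noY Y YG); rewrite properEneq ?BY ?YX.
  + rewrite /nested [[disjoint _ & _]]disjoint_sym disjoints_subset setCD.
    by rewrite (subset_trans h' (subsetUr _ _)) !orbT.
  + by rewrite /nested [Y \subset _]subsetD h disjoint_sym h' orbT.
- by rewrite /nested (disjointWl (subsetDl _ _) h) !orbT.
Qed.

Definition flip_data v A B C :=
  [/\ v = B :|: C, [&& node G A, node G B & node G C], A :|: v \in G,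
      [disjoint A & v] & [disjoint B & C]].

Lemma flip_data_ex v : S \in G -> v \in G -> v != S -> exists A B C, flip_data v A B C.
Proof.
move=> SG vG neS.
have /andP[sv v_gt1] := lamG.1 v vG.
have pv : (S \in G) && (v \proper S) by rewrite SG properEneq neS.
case: (arg_minnP (fun X : {set L} => #|X|) (P := fun X => (X \in G) && (v \proper X)) pv).
move=> X /andP[XG pvX] minX.
have nA : node G (X :\: v).
  apply: node_compl => //; first by rewrite /node vG.
  move=> Y YG vY YX; have := minX Y; rewrite YG vY => /(_ isT).
  by rewrite /= leqNgt (proper_card YX).
have /card_gt0P[b bv] : 0 < #|v| by apply: ltnW.
pose P Y := [&& node G Y, Y \proper v & b \in Y].
have Pb : P [set b].
  rewrite /P /node cards1 eqxx orbT set11 andbT /= properEcard sub1set bv cards1.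
  exact: v_gt1.
case: (arg_maxnP (fun X : {set L} => #|X|) Pb) => B /and3P[nB pB bB] maxB.
have nC : node G (v :\: B).
  apply: node_compl => // Y YG BY Yv; have := maxB Y.
  rewrite /P /node YG Yv (subsetP (proper_sub BY) b bB) => /(_ isT).
  by rewrite /= leqNgt (proper_card BY).
exists (X :\: v), B, (v :\: B); split.
- apply/setP=> x; rewrite !inE; have := subsetP (proper_sub pB) x.
  by case: (x \in B) => //= ->.
- by rewrite nA nB.
- suff -> : X :\: v :|: v = X by [].
  by apply/setP=> x; rewrite !inE; have := subsetP (proper_sub pvX) x; case: (x \in v) => /= [->|_]; rewrite ?orbF.
- by rewrite disjoint_sym disjoints_subset setCD subsetUr.
- by rewrite disjoints_subset setCD subsetUr.
Qed.

Lemma flip_data_neq v A B C : flip_data v A B C ->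
  [/\ A != v, B != v, C != v & A :|: v != v].
Proof.
move=> fl; have [ev /and3P[nA nB nC] XG dAv dBC] := fl.
have /card_gt0P[a aA] := node_gt0 nA.
have /card_gt0P[b bB] := node_gt0 nB.
have /card_gt0P[c cC] := node_gt0 nC.
have av := disjointFr dAv aA.
split; apply/eqP=> e.
- by rewrite -e aA in av.
- by have := disjointFl dBC cC; rewrite e ev inE cC orbT.
- by have := disjointFr dBC bB; rewrite e ev inE bB.
- by rewrite -e inE aA in av.
Qed.

Lemma flip_only v A B C u : flip_data v A B C -> v \in G ->
  u \subset S -> 1 < #|u| -> u \notin G :\ v -> {in G :\ v, forall Y, nested u Y} ->
  [\/ u = v, u = A :|: B | u = A :|: C].
Proof.
move=> fl vG uS u_gt1 uG nu; have [Av Bv Cv neqX] := flip_data_neq fl.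
have [ev /and3P[nA nB nC] XG dAv dBC] := fl.
have [->|nuv] := eqVneq u v; first by constructor 1.
have uG' : u \notin G by move: uG; rewrite !inE nuv.
have bad : ~~ nested u v.
  apply: contra uG' => nuv'; apply: maximal_mem => // Y YG.
  by have [->//|Yv] := eqVneq Y v; apply: nu; rewrite !inE Yv.
have /orP[]// := orbN (nested u v); first by rewrite (negPf bad).
rewrite /nested !negb_or => /and3P[uv vu duv].
have uX : u \subset A :|: v.
  have XG' : A :|: v \in G :\ v by rewrite in_setD1 neqX.
  case/or3P: (nu _ XG') => [//|h|h].
    by rewrite (subset_trans (subsetUr _ _) h) in vu.
  by rewrite (disjointWr (subsetUr _ _) h) in duv.
have neu : u != A :|: v by apply: contraNneq uG' => ->.
have part D : node G D -> D != v -> ~~ (u \subset D) -> (D \subset u) || [disjoint u & D].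
  case/orP=> [DG|/cards1P[x ->]] Dv nuD.
    have DG' : D \in G :\ v by rewrite in_setD1 Dv.
    by case/or3P: (nu _ DG') => [h|->//|->]; [rewrite h in nuD | rewrite orbT].
  by rewrite sub1set disjoint_sym disjoints1 orbN.
have uA : ~~ (u \subset A).
  by apply: contra duv => h; apply: disjointWl h dAv.
have uB : ~~ (u \subset B) by apply: contra uv => h; rewrite ev (subset_trans h) ?subsetUl.
have uC : ~~ (u \subset C) by apply: contra uv => h; rewrite ev (subset_trans h) ?subsetUr.
have pA := part A nA Av uA.
have pB := part B nB Bv uB.
have pC := part C nC Cv uC.
have memX x : x \in u -> [|| x \in A, x \in B | x \in C].
  by move/(subsetP uX); rewrite ev !inE.
case/orP: pA => hA; last first.
  case/negP: uv; rewrite ev; apply/subsetP=> x xu; rewrite inE.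
  by have := memX x xu; rewrite (disjointFr hA xu).
case/orP: pB => hB; case/orP: pC => hC.
- by case/negP: vu; rewrite ev subUset hB.
- constructor 2; apply/eqP; rewrite eqEsubset subUset hA hB !andbT.
  by apply/subsetP=> x xu; have := memX x xu; rewrite (disjointFr hC xu) inE orbF.
- constructor 3; apply/eqP; rewrite eqEsubset subUset hA hC !andbT.
  by apply/subsetP=> x xu; have := memX x xu; rewrite (disjointFr hB xu) inE.
- case/negP: uA; apply/subsetP=> x xu; have := memX x xu.
  by rewrite (disjointFr hB xu) (disjointFr hC xu) !orbF.
Qed.

Lemma flip_data_sym v A B C : flip_data v A B C -> flip_data v A C B.
Proof.
case=> ev /and3P[nA nB nC] XG dAv dBC; split=> //; first by rewrite setUC.
  by rewrite nA nC.
by rewrite disjoint_sym.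
Qed.

Lemma flip_not_nested v A B C : flip_data v A B C -> ~~ nested (A :|: B) v.
Proof.
case=> ev /and3P[nA nB nC] XG dAv dBC.
have /card_gt0P[a aA] := node_gt0 nA.
have /card_gt0P[b bB] := node_gt0 nB.
have /card_gt0P[c cC] := node_gt0 nC.
have cv : c \in v by rewrite ev inE cC orbT.
rewrite /nested !negb_or; apply/and3P; split.
- by apply/subsetP=> /(_ a); rewrite inE aA (disjointFr dAv aA) => /(_ isT).
- apply/subsetP=> /(_ c cv).
  by rewrite inE (disjointFl dBC cC) (disjointFl dAv cv).
- apply/negP => dv; have bAB : b \in A :|: B by rewrite inE bB orbT.
  by have := disjointFr dv bAB; rewrite ev inE bB.
Qed.

Lemma flip_nested v A B C Y : flip_data v A B C -> Y \in G -> v \in G -> Y != v ->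
  nested (A :|: B) Y.
Proof.
move=> fl YG vG Yv; have [ev /and3P[nA nB nC] XG dAv dBC] := fl.
have [[YA YB] YC] := (node_nested nA YG, node_nested nB YG, node_nested nC YG).
have [sYX|nYX] := boolP (Y \subset A :|: v); last first.
  case/or3P: (lamG.2 _ _ XG YG) => [h|h|h]; rewrite ?h // in nYX *.
    rewrite /nested (subset_trans _ h) // ev; apply: setUS; exact: subsetUl.
  rewrite /nested (disjointWl _ h) ?orbT // ev; apply: setUS; exact: subsetUl.
have [sYA|nA'] := boolP (Y \subset A).
  by rewrite /nested (subset_trans sYA (subsetUl _ _)) orbT.
have [sYB|nB'] := boolP (Y \subset B).
  by rewrite /nested (subset_trans sYB (subsetUr _ _)) orbT.
have [sYC|nC'] := boolP (Y \subset C).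
  apply/or3P; constructor 3; apply: (disjointWr sYC).
  rewrite -setI_eq0 setIUl setU_eq0 !setI_eq0 dBC andbT.
  by apply: disjointWr dAv; rewrite ev subsetUr.
have [dYA|mA] := boolP [disjoint A & Y].
  have sYv : Y \subset v.
    apply/subsetP=> x xY; have := subsetP sYX x xY; rewrite inE.
    by rewrite (disjointFl dYA xY).
  have [dYB|mB] := boolP [disjoint B & Y].
    case/negP: nC'; apply/subsetP=> x xY; have := subsetP sYv x xY.
    by rewrite ev inE (disjointFl dYB xY).
  have [dYC|mC] := boolP [disjoint C & Y].
    case/negP: nB'; apply/subsetP=> x xY; have := subsetP sYv x xY.
    by rewrite ev inE (disjointFl dYC xY) orbF.
  case/negP: Yv; rewrite eqEsubset sYv ev subUset.
  by move: YB YC; rewrite /nested (negPf nB') (negPf nC') (negPf mB) (negPf mC) !orbF => -> ->.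
have sAY : A \subset Y.
  by move: YA; rewrite /nested (negPf nA') (negPf mA) !orbF.
have [dYB|mB] := boolP [disjoint B & Y]; last first.
  rewrite /nested subUset sAY.
  by move: YB; rewrite /nested (negPf nB') (negPf mB) !orbF => ->.
have dYv : [disjoint v & Y].
  have [/card_gt0P[a aA] /card_gt0P[b bB]] := (node_gt0 nA, node_gt0 nB).
  case/or3P: (lamG.2 v Y vG YG) => // [/subsetP|/subsetP] h.
    by have := h b; rewrite ev inE bB (disjointFr dYB bB) => /(_ isT).
  by have := h a (subsetP sAY a aA); rewrite (disjointFr dAv aA).
case/negP: nA'; apply/subsetP=> x xY; have := subsetP sYX x xY.
by rewrite inE (disjointFl dYv xY) orbF.
Qed.

End Maximal.
End Laminar.

(** * Determinants of row families *)

Local Open Scope ring_scope.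

Section RowDet.
Variable k : nat.
Implicit Types (s : seq 'rV[int]_k) (u v : 'rV[int]_k).

Definition rows_det s := \det (\matrix_(i < k) nth 0 s i).

Lemma rows_det_zero s i : (i < k)%N -> nth 0 s i = 0 -> rows_det s = 0.
Proof.
move=> ik s0; rewrite /rows_det (expand_det_row _ (Ordinal ik)).
by apply: big1 => j _; rewrite mxE /= s0 mxE mul0r.
Qed.

Lemma rows_det_zero_col s (j : 'I_k) : {in s, forall u, u 0 j = 0} -> rows_det s = 0.
Proof.
move=> s0; rewrite /rows_det (expand_det_col _ j).
apply: big1 => i _; rewrite mxE.
have [lt|ge] := ltnP i (size s); first by rewrite s0 ?mem_nth ?mul0r.
by rewrite nth_default // mxE mul0r.
Qed.

Lemma rows_det_eq s i j : (i < j < k)%N -> nth 0 s i = nth 0 s j -> rows_det s = 0.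
Proof.
case/andP=> ij jk e; have ik := ltn_trans ij jk.
rewrite /rows_det; apply: (@determinant_alternate _ _ _ (Ordinal ik) (Ordinal jk)).
  by rewrite -val_eqE /= neq_ltn ij.
by move=> l; rewrite !mxE /= e.
Qed.

Lemma rows_det_consD s : (0 < k)%N ->
  (forall u v, rows_det ((u + v) :: s) = rows_det (u :: s) + rows_det (v :: s)).
Proof.
move=> k_gt0 u v; rewrite /rows_det.
rewrite (@determinant_multilinear _ _ _ (\matrix_(i < k) nth 0 (u :: s) i)
  (\matrix_(i < k) nth 0 (v :: s) i) (Ordinal k_gt0) 1 1) ?mul1r //.
- by apply/rowP=> j; rewrite !mxE /= ?mxE ?mul1r.
- by apply/matrixP=> i j; rewrite !mxE.
- by apply/matrixP=> i j; rewrite !mxE.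
Qed.

Lemma rows_det_cons_mem s u : (size s < k)%N -> u \in s -> rows_det (u :: s) = 0.
Proof.
move=> sz us; apply: (@rows_det_eq _ 0 (index u s).+1) => /=.
  by apply: leq_ltn_trans sz; rewrite index_mem.
by rewrite nth_index.
Qed.

Lemma rows_det_orthonormal s :
  (forall i j : 'I_k, (nth 0 s i *m (nth 0 s j)^T) 0 0 = (i == j)%:R) -> rows_det s ^+ 2 = 1.
Proof.
move=> orth; rewrite expr2 /rows_det -[X in _ * X]det_tr -det_mulmx.
set M := _ *m _; suff -> : M = 1%:M by rewrite det1.
apply/matrixP=> i j; have := orth i j; rewrite !mxE => <-.
by apply: eq_bigr => l _; rewrite !mxE.
Qed.

Lemma rows_det_cons0 s : (0 < k)%N -> rows_det (0 :: s) = 0.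
Proof. by move=> k_gt0; apply: (@rows_det_zero _ 0). Qed.

End RowDet.

Lemma rows_det_insert k (s1 s2 : seq 'rV[int]_k) (u : 'rV[int]_k) :
  (size s1 < k)%N -> rows_det (s1 ++ u :: s2) = (-1) ^+ size s1 * rows_det (u :: s1 ++ s2).
Proof.
case: k s1 s2 u => // k s1 s2 u lt.
rewrite /rows_det (expand_det_row _ (Ordinal lt)) (expand_det_row _ ord0) mulr_sumr.
apply: eq_bigr => j _; rewrite !mxE /= nth_cat ltnn subnn /= [RHS]mulrCA; congr (_ * _).
rewrite /cofactor mulrA -exprD /= add0n; congr (_ * \det _).
apply/matrixP=> i l; rewrite !mxE /=; congr (fun_of_matrix _ _ _).
rewrite /bump /=; have [le|gt] := leqP (size s1) i.
  by rewrite /= !add1n !nth_cat ltnNge (leqW le) subSn //=; rewrite ?nth_cat ltnNge le.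
by rewrite /= ?add0n ?add1n /= !nth_cat gt.
Qed.

Lemma enum_insert (V : finType) (F : {set V}) (v : V) : v \notin F ->
  exists s1 s2, [/\ enum (v |: F) = s1 ++ v :: s2, enum F = s1 ++ s2 &
                    face_index F v = size s1].
Proof.
move=> vF; have vV : v \in enum V by rewrite mem_enum.
have uV := enum_uniq V.
have [t1 [t2 eV]] : exists t1 t2, enum V = t1 ++ v :: t2.
  by case/splitPr: vV => t1 t2; exists t1, t2.
move: uV; rewrite eV cat_uniq /= negb_or => /and3P[u1 /andP[vt1 _] /andP[vt2 u2]].
exists [seq x <- t1 | x \in F], [seq x <- t2 | x \in F]; split.
- rewrite {1}/enum_mem -enumT eV filter_cat /= !inE eqxx /=.
  congr (_ ++ _ :: _); apply: eq_in_filter => x xt; rewrite /= !inE;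
    by case: eqVneq => // e; rewrite e ?(negPf vt1) ?(negPf vt2) in xt.
- by rewrite {1}/enum_mem -enumT eV filter_cat /= (negPf vF).
- have rk x : enum_rank x = index x (t1 ++ v :: t2) :> nat.
    rewrite -eV -{2}(nth_enum_rank v x) index_uniq ?enum_uniq //.
    by rewrite -cardE.
  rewrite /face_index -(card_uniqP (filter_uniq _ u1)); apply: eq_card => x.
  rewrite !inE mem_filter; congr (_ && _).
  rewrite !rk !index_cat (negPf vt1) /= eqxx addn0.
  case: ifP => xt1; first by rewrite index_mem xt1.
  by apply/negbTE; rewrite -leqNgt leq_addr.
Qed.

Lemma boundary_rows_det (V : finType) k (r : V -> 'rV[int]_k) (F : {set V}) (v : V) :
  v \notin F -> (#|F|.+1 = k)%N ->
  (-1) ^+ face_index F v * rows_det (map r (enum (v |: F))) = rows_det (r v :: map r (enum F)).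
Proof.
move=> vF cF; have [s1 [s2 [e1 e2 ->]]] := enum_insert vF.
rewrite e1 e2 !map_cat /= rows_det_insert size_map.
  by rewrite mulrA -exprD addnn -mul2n exprM sqrrN expr1n mul1r.
by rewrite -cF ltnS cardE e2 size_cat leq_addr.
Qed.

(** * Bracket rows of a word *)

Section BracketRow.
Variables (L : finType) (k : nat).
Implicit Types (W : nat -> L) (A B C : {set L}).

Definition adj W A j := (W j \in A) && (W j.+1 \in A).

Definition bracket_row W A : 'rV[int]_k := \row_j ((adj W A j)%:R - (adj W A j.+1)%:R).

Definition word_inj W := {in gtn k.+2 &, injective W}.

Lemma bracket_row_ext W W' A A' :
  (forall j, (j <= k)%N -> adj W A j = adj W' A' j) -> bracket_row W A = bracket_row W' A'.
Proof. by move=> e; apply/rowP=> j; rewrite !mxE !e // ltnW. Qed.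

Lemma bracket_row0 W A : (forall j, (j <= k)%N -> adj W A j = false) -> bracket_row W A = 0.
Proof. by move=> e; apply/rowP=> j; rewrite !mxE !e // ltnW. Qed.

Lemma bracket_row1 W A : word_inj W -> #|A| = 1%N -> bracket_row W A = 0.
Proof.
move=> injW /eqP/cards1P[x ->]; apply: bracket_row0 => j jk.
apply/negP; rewrite /adj !inE => /andP[/eqP e1 /eqP e2].
by have := injW j j.+1; rewrite !inE !ltnS jk e1 e2 ltnW // => /(_ isT isT erefl); lia.
Qed.

Lemma bracket_row_full W A : (forall j, (j < k.+2)%N -> W j \in A) -> bracket_row W A = 0.
Proof.
move=> e; apply/rowP=> j; rewrite !mxE /adj !e ?subrr //; have := ltn_ord j; lia.
Qed.

Lemma bracket_row_flip W A B C : [disjoint A & B] -> [disjoint A & C] -> [disjoint B & C] ->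
  bracket_row W (A :|: B) + bracket_row W (A :|: C) + bracket_row W (B :|: C) =
  bracket_row W (A :|: B :|: C) + bracket_row W A + bracket_row W B + bracket_row W C.
Proof.
move=> dAB dAC dBC.
have key j : (adj W (A :|: B) j + adj W (A :|: C) j + adj W (B :|: C) j =
              adj W (A :|: B :|: C) j + adj W A j + adj W B j + adj W C j)%N.
  rewrite /adj !inE.
  have D x : ~~ ((x \in A) && (x \in B)) && ~~ ((x \in A) && (x \in C))
             && ~~ ((x \in B) && (x \in C)).
    apply/andP; split; first apply/andP; first split.
    - by apply/negP => /andP[h]; rewrite (disjointFr dAB h).
    - by apply/negP => /andP[h]; rewrite (disjointFr dAC h).
    - by apply/negP => /andP[h]; rewrite (disjointFr dBC h).
  move: (D (W j)) (D (W j.+1)).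
  by case: (W j \in A); case: (W j \in B); case: (W j \in C);
     case: (W j.+1 \in A); case: (W j.+1 \in B); case: (W j.+1 \in C).
have lin (a1 a2 a3 a4 a5 a6 a7 b1 b2 b3 b4 b5 b6 b7 : int) :
    a1 + a2 + a3 = a4 + a5 + a6 + a7 -> b1 + b2 + b3 = b4 + b5 + b6 + b7 ->
    (a1 - b1) + (a2 - b2) + (a3 - b3) = (a4 - b4) + (a5 - b5) + (a6 - b6) + (a7 - b7).
  by clear; lia.
by apply/rowP=> j; rewrite !mxE; apply: lin; rewrite -!natrD key.
Qed.

Lemma bracket_row_perm (t : L -> L) W A : (forall x, (t x \in A) = (x \in A)) ->
  bracket_row (t \o W) A = bracket_row W A.
Proof. by move=> e; apply: bracket_row_ext => j _; rewrite /adj /= !e. Qed.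

Definition prefix_set W l : {set L} := [set W i | i : 'I_l.+1].

Lemma mem_prefix_set W l x : (x \in prefix_set W l) = [exists i : 'I_l.+1, x == W i].
Proof.
apply/imsetP/existsP => [[i _ ->]|[i /eqP ->]]; by exists i.
Qed.

Lemma word_prefix W W' t j : word_inj W' -> (forall i, (i <= t)%N -> W i = W' i) ->
  (t <= k.+1)%N -> (j < k.+2)%N -> word_inj W -> (W j \in prefix_set W' t) = (j <= t)%N.
Proof.
move=> injW' e tk jk injW; rewrite mem_prefix_set; apply/existsP/idP => [[i /eqP]|jt].
  have it : (i <= t)%N by rewrite -ltnS.
  rewrite -e // => /injW; rewrite !inE jk => -> //.
  by rewrite ltnS (leq_trans it).
by exists (Ordinal (jt : (j < t.+1)%N)); rewrite e.
Qed.

Lemma bracket_row_prefix W l : word_inj W -> (0 < l <= k)%N ->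
  bracket_row W (prefix_set W l) = \row_j (j.+1 == l)%:R.
Proof.
move=> injW /andP[l0 lk]; apply/rowP=> j; rewrite !mxE /adj.
have jk := ltn_ord j.
rewrite !(word_prefix (t := l)) //; try lia.
Qed.

Lemma bracket_row_prefix_neq W W' t : word_inj W -> word_inj W' ->
  (forall i, (i <= t)%N -> W i = W' i) -> (t.+1 <= k)%N -> W t.+1 != W' t.+1 ->
  bracket_row W (prefix_set W' t.+1) = bracket_row W (prefix_set W' t).
Proof.
move=> injW injW' e tk ne; apply: bracket_row_ext => j jk.
have mem i : (i < k.+2)%N ->
    (W i \in prefix_set W' t.+1) = (i <= t)%N || (W i == W' t.+1).
  move=> ik; rewrite -(word_prefix (W := W) injW' e _ ik) //; last by lia.
  rewrite !mem_prefix_set; apply/existsP/orP => [[a ea]|[/existsP[a ea]|ea]].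
  - have := ltn_ord a; rewrite ltnS leq_eqVlt => /orP[/eqP at1|lt].
      by right; rewrite -at1.
    by left; apply/existsP; exists (Ordinal lt).
  - by exists (widen_ord (leqnSn _) a).
  - by exists ord_max.
have neq i : (i < k.+2)%N -> W i == W' t.+1 -> (t.+1 < i)%N.
  move=> ik /eqP ei; rewrite ltnNge; apply/negP; rewrite leq_eqVlt => /orP[/eqP it|it].
    by rewrite it in ei; rewrite ei eqxx in ne.
  have : i = t.+1 by apply: injW'; rewrite ?inE -?(e i) //; clear -tk; lia.
  by clear -it; lia.
rewrite /adj !mem ?(word_prefix (t := t)) //; try lia.
have : ~~ ((W j.+1 == W' t.+1) && (W j == W' t.+1)).
  apply/negP => /andP[/eqP <- /eqP/injW]; rewrite !inE => e'.
  by have := e' (leqW jk) jk; clear; lia.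
have := neq j (leqW jk); have := neq j.+1 jk; clear.
case: (W j.+1 == _) => [/(_ isT) h1|_]; case: (W j == _) => [/(_ isT) h2|_] // _;
  rewrite ?orbT ?orbF; lia.
Qed.

Lemma comb_det_neq0 W W' (s : seq {set L}) : word_inj W -> word_inj W' -> W 0 = W' 0 ->
  size s = k -> (forall l, (0 < l <= k)%N -> prefix_set W' l \in s) ->
  rows_det (map (bracket_row W) s) != 0 -> forall t, (t <= k)%N -> W t = W' t.
Proof.
move=> injW injW' e0 sz sP nz t; elim/ltn_ind: t => -[//|t] IH tk.
apply/eqP; apply: contraT => ne; case/negP: nz; apply/eqP.
have agree i : (i <= t)%N -> W i = W' i by move=> it; apply: IH => //; lia.
have e := bracket_row_prefix_neq injW injW' agree tk ne.
have nthi l : (0 < l <= k)%N -> (index (prefix_set W' l) s < k)%N.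
  by move=> h; rewrite -sz index_mem sP.
have nthE l : (0 < l <= k)%N ->
    nth 0 (map (bracket_row W) s) (index (prefix_set W' l) s) = bracket_row W (prefix_set W' l).
  by move=> h; rewrite (nth_map set0) ?nth_index ?sP // sz nthi.
case: t => [|t] in IH tk ne agree e *.
  apply: (@rows_det_zero _ _ (index (prefix_set W' 1) s)); first exact: nthi.
  rewrite nthE // e; apply: bracket_row1 => //.
  rewrite /prefix_set card_imset ?card_ord // => i j _; by rewrite [i]ord1 [j]ord1.
have neI : index (prefix_set W' t.+2) s != index (prefix_set W' t.+1) s.
  apply/eqP => /(congr1 (nth set0 s)); rewrite !nth_index ?sP //; try lia.
  move/setP/(_ (W' t.+2)).
  rewrite !(word_prefix (W := W')) //; try lia.
case: (ltngtP (index (prefix_set W' t.+2) s) (index (prefix_set W' t.+1) s)) neI => // lt _.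
  apply: (rows_det_eq (i := index (prefix_set W' t.+2) s) (j := index (prefix_set W' t.+1) s)).
    by rewrite lt nthi //= ltnW.
  by rewrite !nthE ?e //= ltnW.
apply: (rows_det_eq (i := index (prefix_set W' t.+1) s) (j := index (prefix_set W' t.+2) s)).
  by rewrite lt nthi.
by rewrite !nthE ?e //= ltnW.
Qed.

Lemma comb_det_sq W (s : seq {set L}) : word_inj W -> uniq s -> size s = k ->
  {in s, forall A, exists2 l, (0 < l <= k)%N & A = prefix_set W l} ->
  rows_det (map (bracket_row W) s) ^+ 2 = 1.
Proof.
move=> injW us sz sP; apply: rows_det_orthonormal => i j.
rewrite !(nth_map set0) ?sz //.
have [|a ha ea] := sP (nth set0 s i); first by rewrite mem_nth ?sz.
have [|b hb eb] := sP (nth set0 s j); first by rewrite mem_nth ?sz.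
have -> : (i == j) = (a == b).
  rewrite -val_eqE -(@nth_uniq _ set0 s i j) ?sz // ea eb.
  apply/eqP/eqP => [/setP e|->//].
  have := e (W a); have := e (W b).
  rewrite !(word_prefix (W := W)) //; lia.
rewrite ea eb !bracket_row_prefix // mxE.
have ak : (a.-1 < k)%N by lia.
rewrite (bigD1 (Ordinal ak)) //= big1 => [|l ne].
  by rewrite !mxE /= prednK ?eqxx ?mul1r ?addr0 //; lia.
rewrite !mxE; case: eqP => [e|]; last by rewrite mul0r.
by case/negP: ne; rewrite -val_eqE /= -e.
Qed.

End BracketRow.

Local Close Scope ring_scope.

(** * Faces of the complex of bicolored splits *)

Lemma mem_split_blocks (L : finType) (A : {set L}) : A \in [set A; ~: A] /\ ~: A \in [set A; ~: A].
Proof. by rewrite !inE !eqxx orbT. Qed.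

Lemma quot_eq0_iso (U V : zmodType) (I : zmodClosed U) (g : {additive U -> V}) :
  {in I, forall x, x = 0%R} -> bijective g ->
  exists f : {additive Quotient.quot I -> V}, bijective f.
Proof.
move=> I0 [h gK hK].
have pi_inj (x y : U) : (x = y %[mod Quotient.quot I])%qT -> x = y.
  by move/eqP; rewrite -Quotient.idealrBE => /I0/eqP; rewrite GRing.subr_eq0 => /eqP.
pose f (x : Quotient.quot I) : V := g (repr x).
have fB : GRing.zmod_morphism f.
  move=> x y; rewrite /f -GRing.raddfB; congr (g _); apply: pi_inj.
  by rewrite reprK [RHS]GRing.raddfB /= !reprK.
pose fM := GRing.isZmodMorphism.Build _ _ f fB.
pose fA : {additive Quotient.quot I -> V} := HB.pack f fM.
exists fA; exists (fun v => \pi_(Quotient.quot I)%qT (h v)) => [x|v] /=.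
  by rewrite /f gK reprK.
by rewrite /f -[RHS]hK; congr (g _); apply: pi_inj; rewrite reprK.
Qed.

Section Bicolored.
Variables (d n : nat).
Hypotheses (hd : 2 <= d) (hn : 2 <= n).
Local Notation N := (n + d).
Local Notation k := (N - 3).
Local Notation K := (T'' d n).
Implicit Types (A B U : {set 'I_N}) (P Q u v : {set {set 'I_N}}) (F T : {set {set {set 'I_N}}}).

Fact N_gt0 : 0 < N. Proof. by clear -hn; lia. Qed.
Fact N_last : N.-1 < N. Proof. by rewrite prednK ?N_gt0. Qed.

Definition first_leaf : 'I_N := Ordinal N_gt0.
Definition last_leaf : 'I_N := Ordinal N_last.
Local Notation o := first_leaf.
Local Notation z := last_leaf.

Definition color (i : 'I_N) := marked n (label i).

Lemma color_first : color o. Proof. by rewrite /color /marked /label /=; clear -hn; lia. Qed.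
Lemma color_last : ~~ color z. Proof. by rewrite /color /marked /label /=; clear -hd hn; lia. Qed.

Definition split A : {set {set 'I_N}} := [set A; ~: A].

(* The block of a split that does not contain the last leaf. *)
Definition side P : {set 'I_N} := [set x | ~~ [exists A in P, (x \in A) && (z \in A)]].

Definition bicolored A :=
  [&& z \notin A, [exists i in A, color i], [exists i in A, ~~ color i]
    & [exists i in ~: A, color i]].

Lemma side_split A : z \notin A -> side (split A) = A.
Proof.
move=> zA; apply/setP=> x; rewrite inE.
apply/idP/idP => [|xA]; last first.
  by apply/existsP=> -[B]; rewrite !inE => /andP[/orP[]/eqP-> /andP[]];
     rewrite ?inE ?(negPf zA) ?xA.
apply: contraR => xA; apply/existsP; exists (~: A).
by rewrite !inE eqxx orbT xA zA.
Qed.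

Lemma bicolored_gt1 A : bicolored A -> 1 < #|A|.
Proof.
case/and4P=> _ /existsP[i /andP[iA ci]] /existsP[j /andP[jA cj]] _.
apply/card_gt1P; exists i, j; split => //.
by apply: contraNneq cj => <-.
Qed.

Lemma bicolored_splitE A : bicolored A -> bicolored_split (split A).
Proof.
move=> bA; have A_gt1 := bicolored_gt1 bA.
case/and4P: bA => zA eA1 eA2 /existsP[i /andP[iA ci]].
have iz : i != z by apply: contraNneq color_last => <-.
have zC : z \in ~: A by rewrite inE.
have neA : A != ~: A by apply: contraNneq zA => ->.
apply/and3P; split; last first.
- apply/forallP=> B; apply/implyP; rewrite !inE => /orP[]/eqP->.
    by rewrite A_gt1 eA1.
  apply/and3P; split.
  + by apply/card_gt1P; exists i, z.
  + by apply/existsP; exists i; rewrite iA.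
  + by apply/existsP; exists z; rewrite zC color_last.
- by rewrite cards2 neA.
- apply/and3P; split.
  + by rewrite /cover big_setU1 ?inE //= big_set1 setUCr.
  + apply/trivIsetP=> B C; rewrite !inE => /orP[]/eqP-> /orP[]/eqP->; rewrite ?eqxx //= => _.
      by rewrite disjoints_subset setCK.
    by rewrite disjoint_sym disjoints_subset setCK.
  + rewrite !inE negb_or; apply/andP; split.
      by apply/eqP=> e; rewrite -e cards0 in A_gt1.
    by apply/eqP=> e; rewrite -e inE in zC.
Qed.

Lemma bicolored_splitP P : bicolored_split P -> exists2 A, P = split A & bicolored A.
Proof.
case/and3P=> /and3P[/eqP cov /trivIsetP tr n0] /cards2P[A [B [neAB eP]]] /forallP col.
have BA : B = ~: A.
  apply/setP=> x; rewrite inE.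
  have dAB : [disjoint A & B] by apply: tr; rewrite // eP !inE eqxx ?orbT.
  have : x \in cover P by rewrite cov inE.
  rewrite eP /cover big_setU1 ?inE //= ?big_set1 ?inE.
  by case: (boolP (x \in A)) => [xA|//]; rewrite (disjointFr dAB xA).
wlog zA : A B neAB eP BA / z \notin A.
  move=> H; have [zA|] := boolP (z \in A); last exact: (H A B).
  apply: (H B A); [by rewrite eq_sym | by rewrite eP setUC | by rewrite BA setCK |].
  by rewrite BA inE zA.
exists A; first by rewrite eP BA.
have := col A; have := col B; rewrite eP !inE !eqxx orbT /= => /and3P[_ eB1 _] /and3P[_ eA1 eA2].
by rewrite /bicolored zA eA1 eA2 -BA eB1.
Qed.

Lemma compatible_split A B : z \notin A -> z \notin B ->
  compatible (split A) (split B) = nested A B.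
Proof.
move=> zA zB; apply/existsP/or3P => [[X /andP[XA /existsP[Y /andP[YB XY]]]]|].
  move: XA YB XY; rewrite !inE => /orP[]/eqP-> /orP[]/eqP->.
  - by rewrite setI_eq0; constructor 3.
  - by rewrite -setDE setD_eq0; constructor 1.
  - by rewrite setIC -setDE setD_eq0; constructor 2.
  - by move/eqP/setP/(_ z); rewrite !inE zA zB.
have [[A1 A2] [B1 B2]] := (mem_split_blocks A, mem_split_blocks B).
case=> h; [exists A | exists (~: A) | exists A]; rewrite ?A1 ?A2 /=; apply/existsP.
- by exists (~: B); rewrite B2 -setDE setD_eq0.
- by exists B; rewrite B1 setIC -setDE setD_eq0.
- by exists B; rewrite B1 setI_eq0.
Qed.

Lemma face_split F P : F \in K -> P \in F -> P = split (side P) /\ bicolored (side P).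
Proof.
rewrite inE => /andP[/forallP h _] PF; have := h P; rewrite PF => /bicolored_splitP[A eP bA].
by rewrite eP side_split //; case/andP: bA.
Qed.

Lemma bicolored_last A : bicolored A -> z \notin A. Proof. by case/andP. Qed.

Lemma face_nested F P Q : F \in K -> P \in F -> Q \in F -> nested (side P) (side Q).
Proof.
move=> FK PF QF; have [eP bP] := face_split FK PF; have [eQ bQ] := face_split FK QF.
rewrite -compatible_split ?bicolored_last // -eP -eQ.
move: FK; rewrite inE => /andP[_ /forallP/(_ P)]; rewrite PF => /forallP/(_ Q).
by rewrite QF.
Qed.

Lemma faceP F : {in F, forall P, exists2 A, P = split A & bicolored A} ->
  {in F &, forall P Q, nested (side P) (side Q)} -> F \in K.
Proof.
move=> h1 h2; rewrite inE; apply/andP; split.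
  by apply/forallP=> P; apply/implyP=> /h1[A -> /bicolored_splitE].
apply/forallP=> P; apply/implyP=> PF; apply/forallP=> Q; apply/implyP=> QF.
have := h2 P Q PF QF; have [[A -> bA] [B -> bB]] := (h1 P PF, h1 Q QF).
by rewrite !side_split ?compatible_split ?bicolored_last.
Qed.

Lemma face_sub F T : F \subset T -> T \in K -> F \in K.
Proof.
move=> /subsetP FT TK; apply: faceP => [P /FT PT|P Q /FT PT /FT QT].
  by have [e b] := face_split TK PT; exists (side P).
exact: face_nested TK _ _.
Qed.

Lemma face_add F U : F \in K -> bicolored U -> {in F, forall P, nested U (side P)} ->
  split U |: F \in K.
Proof.
move=> FK bU nU; have zU := bicolored_last bU.
apply: faceP => [P /setU1P[->|PF]|P Q /setU1P[->|PF] /setU1P[->|QF]].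
- by exists U.
- by have [e b] := face_split FK PF; exists (side P).
- by rewrite /nested subxx.
- by rewrite side_split // nU.
- by rewrite nestedC side_split // nU.
- exact: face_nested FK _ _.
Qed.

Lemma side_inj F : F \in K -> {in F &, injective side}.
Proof.
move=> FK P Q PF QF e; have [-> _] := face_split FK PF; have [-> _] := face_split FK QF.
by rewrite e.
Qed.

Definition leaves : {set 'I_N} := [set~ z].
Definition family F : {set {set 'I_N}} := leaves |: side @: F.

Lemma bicolored_leaves A : bicolored A -> A \subset leaves.
Proof. by move=> bA; rewrite subsetC sub1set inE bicolored_last. Qed.

Lemma leaves_not_bicolored : ~~ bicolored leaves.
Proof.
apply/negP => /and4P[_ _ _ /existsP[i]]; rewrite setCK inE => /andP[/eqP->].
by rewrite (negPf color_last).
Qed.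

Lemma leaves_notin F : F \in K -> leaves \notin side @: F.
Proof.
move=> FK; apply/imsetP=> -[P PF e]; have [_] := face_split FK PF.
by rewrite -e (negPf leaves_not_bicolored).
Qed.

Lemma card_leaves : #|leaves| = N.-1.
Proof. by rewrite cardsC1 card_ord. Qed.

Lemma card_family F : F \in K -> #|family F| = #|F|.+1.
Proof.
move=> FK; rewrite cardsU1 leaves_notin // card_in_imset //.
exact: side_inj.
Qed.

Lemma family_laminar F : F \in K -> laminar_in leaves (family F).
Proof.
move=> FK; split=> [X /setU1P[->|/imsetP[P PF ->]]|].
- by rewrite subxx card_leaves; clear -hd hn; lia.
- have [_ b] := face_split FK PF.
  by rewrite bicolored_leaves // bicolored_gt1.
move=> X Y /setU1P[->|/imsetP[P PF ->]] /setU1P[->|/imsetP[Q QF ->]].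
- by rewrite /nested subxx.
- by have [_ b] := face_split FK QF; rewrite /nested bicolored_leaves ?orbT.
- by have [_ b] := face_split FK PF; rewrite /nested bicolored_leaves.
- exact: face_nested FK _ _.
Qed.

Lemma face_card F : F \in K -> #|F| <= k.
Proof.
move=> FK; have := laminar_bound (family_laminar FK).
by rewrite card_family // card_leaves; clear -hd hn; lia.
Qed.

Lemma family_max F : F \in K -> #|F| = k -> #|family F| = #|leaves|.-1.
Proof. by move=> FK cF; rewrite card_family // card_leaves cF; clear -hd hn; lia. Qed.

Lemma side_in_family T v : T \in K -> v \in T -> side v \in family T /\ side v != leaves.
Proof.
move=> TK vT; have [_ b] := face_split TK vT; split; first by rewrite !inE imset_f ?orbT.
by apply: contraTneq b => ->; exact: leaves_not_bicolored.
Qed.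

Lemma family_del T v X : T \in K -> v \in T -> X \in family T :\ side v ->
  X = leaves \/ exists2 P, P \in T :\ v & X = side P.
Proof.
move=> TK vT /setD1P[Xv /setU1P[->|/imsetP[P PT e]]]; [by left|right].
by exists P => //; rewrite !inE PT andbT; apply: contraNneq Xv => <-; rewrite e.
Qed.

Lemma face_flip_only T v u A B C : T \in K -> #|T| = k -> v \in T ->
  flip_data (family T) (side v) A B C -> u \notin T :\ v -> u |: (T :\ v) \in K ->
  [\/ u = v, u = split (A :|: B) | u = split (A :|: C)].
Proof.
move=> TK cT vT fl uT uK.
have [eu bu] := face_split uK (setU11 u (T :\ v)).
have [ev bv] := face_split TK vT.
have [vG _] := side_in_family TK vT.
suff : [\/ side u = side v, side u = A :|: B | side u = A :|: C].
  by case=> e; [constructor 1 | constructor 2 | constructor 3]; rewrite eu e // -ev.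
apply: (flip_only (family_laminar TK) (family_max TK cT) fl vG).
- exact: bicolored_leaves.
- exact: bicolored_gt1.
- apply/negP => /(family_del TK vT)[e|[P PT e]].
    by rewrite e (negPf leaves_not_bicolored) in bu.
  case/negP: uT; rewrite eu e.
  by have [<- _] := face_split TK (subsetP (subsetDl _ _) P PT).
- move=> Y /(family_del TK vT)[->|[P PT ->]].
    by rewrite /nested bicolored_leaves.
  by apply: (face_nested uK); rewrite !inE ?eqxx // -in_setD1 PT orbT.
Qed.

Local Open Scope ring_scope.

Lemma cycle_flip0 (c : {ffun {set {set {set 'I_N}}} -> int}) T v :
  boundary c = 0 -> v \in T ->
  (forall u, u \notin T :\ v -> u != v -> c (u |: (T :\ v)) = 0) -> c T = 0.
Proof.
move=> bc vT h; have := congr1 (fun f : {ffun _ -> int} => f (T :\ v)) bc.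
rewrite !ffunE (bigD1 v) ?inE ?eqxx //= big1 => [|u /andP[uT uv]]; last by rewrite h ?mulr0.
by rewrite setD1K // addr0 => /eqP; rewrite mulf_eq0 signr_eq0 => /eqP.
Qed.

(** * Words and combs *)

Local Close Scope ring_scope.
Local Open Scope nat_scope.

Definition leaf (x : nat) : 'I_N := insubd z x.-1.

Lemma leafK x : 0 < x <= N -> label (leaf x) = x.
Proof.
by case/andP=> x0 xN; rewrite /label /leaf insubdK ?prednK // -topredE /= -ltnS !prednK.
Qed.

Lemma labelK i : leaf (label i) = i.
Proof. by apply: val_inj; rewrite /leaf /label insubdK //= -topredE /= ltn_ord. Qed.

Lemma label_last : label z = N.
Proof. by rewrite /label /= prednK ?N_gt0. Qed.

Definition word (m : seq nat) j : 'I_N := leaf (nth 0 (1 :: m) j).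

Section Word.
Variable m : seq nat.
Hypothesis hm : m \in inner_orderings d n.

Lemma ordering_perm : perm_eq m (iota 2 (N - 2)).
Proof. by move: hm; rewrite mem_permutations. Qed.

Lemma size_ordering : size m = k.+1.
Proof. by rewrite (perm_size ordering_perm) size_iota; clear -hd hn; lia. Qed.

Lemma uniq_ordering : uniq (1 :: m).
Proof.
by rewrite /= (perm_mem ordering_perm) mem_iota (perm_uniq ordering_perm) iota_uniq.
Qed.

Lemma mem_ordering x : (x \in m) = (1 < x < N).
Proof. by rewrite (perm_mem ordering_perm) mem_iota; clear -hd hn; lia. Qed.

Lemma nth_ordering j : j < k.+2 -> 0 < nth 0 (1 :: m) j < N.
Proof.
rewrite -size_ordering -[(size m).+1]/(size (1 :: m)) => /(mem_nth 0).
rewrite inE mem_ordering => /orP[/eqP->|/andP[/ltnW-> ->//]].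
by clear -hn; lia.
Qed.

Lemma label_word j : j < k.+2 -> label (word m j) = nth 0 (1 :: m) j.
Proof. by move=> /nth_ordering h; rewrite leafK //; case/andP: h => -> /ltnW. Qed.

Lemma word_word_inj : word_inj k (word m).
Proof.
move=> i j; rewrite !inE => ik jk /(congr1 (@label _)); rewrite !label_word // => /eqP.
by rewrite nth_uniq ?uniq_ordering //= ?size_ordering // => /eqP.
Qed.

Lemma word0 : word m 0 = o.
Proof. by apply: val_inj; rewrite /word /leaf /= insubdK // -topredE /= N_gt0. Qed.

Lemma word_neq_last j : j < k.+2 -> word m j != z.
Proof.
move=> jk; apply/eqP=> /(congr1 (@label _)); rewrite label_word // label_last => e.
by have /andP[_] := nth_ordering jk; rewrite e ltnn.
Qed.

Lemma word_onto x : x != z -> exists2 j, j < k.+2 & x = word m j.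
Proof.
move=> xz; have lx : label x \in 1 :: m.
  rewrite inE mem_ordering; have := ltn_ord x; rewrite -val_eqE /= in xz.
  by move: xz; rewrite /label; clear; lia.
exists (index (label x) (1 :: m)); last by rewrite /word nth_index // labelK.
by rewrite -size_ordering -[(size m).+1]/(size (1 :: m)) index_mem.
Qed.

Lemma color_word j : j < k.+2 -> color (word m j) = marked n (nth 0 (1 :: m) j).
Proof. by move=> jk; rewrite /color label_word. Qed.

Local Notation pre := (prefix_set (word m)).

Lemma word_in_prefix l j : l <= k.+1 -> j < k.+2 -> (word m j \in pre l) = (j <= l).
Proof. by move=> lk jk; apply: (word_prefix word_word_inj) word_word_inj. Qed.

Lemma last_notin_prefix l : l <= k.+1 -> z \notin pre l.
Proof.
move=> lk; rewrite mem_prefix_set; apply/existsP=> -[i /eqP e].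
have ik : i < k.+2 by apply: leq_trans (ltn_ord i) _.
by have := word_neq_last ik; rewrite -e eqxx.
Qed.

Lemma side_prefix l : l <= k.+1 -> side (split (pre l)) = pre l.
Proof. by move=> lk; rewrite side_split ?last_notin_prefix. Qed.

Lemma tail_split_prefix l : l <= k -> tail_split N m l.+1 = split (pre l).
Proof.
move=> lk; rewrite /tail_split /split /=.
suff -> : [set i : 'I_N | label i \in rcons (drop l m) N] = ~: pre l.
  by rewrite setCK setUC.
apply/setP=> i; rewrite !inE mem_rcons inE.
have [->|/word_onto[j jk ->]] := eqVneq i z.
  by rewrite last_notin_prefix ?leqW // label_last eqxx.
rewrite (word_in_prefix (leqW lk) jk) label_word //.
have /andP[_ jN] := nth_ordering jk; rewrite (ltn_eqF jN) /=.
have /andP[m1 um] : (1 \notin m) && uniq m := uniq_ordering.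
case: j jk jN => [_ _|j jk jN].
  by apply/negbTE; apply: contra m1; exact: mem_drop.
have jm : nth 0 m j \in m by rewrite mem_nth // size_ordering.
have jx : index (nth 0 m j) m = j by rewrite index_uniq // size_ordering.
have : nth 0 m j \in take l m ++ drop l m by rewrite cat_take_drop.
have : uniq (take l m ++ drop l m) by rewrite cat_take_drop.
rewrite cat_uniq mem_cat => /and3P[_ /hasPn h _].
rewrite in_take // jx; case: ltnP => //= jl _; apply/negbTE/negP => /h.
by rewrite in_take // jx jl.
Qed.

Lemma combP P : reflect (exists2 l, 0 < l <= k & P = split (pre l)) (P \in comb N m).
Proof.
rewrite inE; apply: (iffP mapP) => [[l]|[l lk ->]].
  rewrite mem_iota => lk ->; exists l.-1; first by clear -lk hd hn; lia.
  by rewrite -tail_split_prefix ?prednK //; clear -lk hd hn; lia.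
exists l.+1; first by rewrite mem_iota; clear -lk hd hn; lia.
by rewrite tail_split_prefix //; case/andP: lk.
Qed.

Lemma prefix_inj i j : i <= k -> j <= k -> pre i = pre j -> i = j.
Proof.
move=> ik jk /setP e; have := e (word m i); have := e (word m j).
by rewrite !word_in_prefix ?leqnn; clear -ik jk; lia.
Qed.

Lemma card_comb : #|comb N m| = k.
Proof.
rewrite /comb cardsE; set s := map _ _.
have -> : k = size s by rewrite size_map size_iota.
apply/eqP; rewrite -(rwP eqP); apply/card_uniqP; rewrite map_inj_in_uniq ?iota_uniq //.
move=> i j; rewrite !mem_iota => ik jk.
have [i0 j0] : 0 < i /\ 0 < j by clear -ik jk; lia.
rewrite -(prednK i0) -(prednK j0) !tail_split_prefix; try by clear -ik jk; lia.
move/(congr1 side); rewrite !side_prefix; try by clear -ik jk; lia.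
by move/prefix_inj => -> //; clear -ik jk; lia.
Qed.

Lemma last_ordering : last 0 m = nth 0 (1 :: m) k.+1.
Proof. by rewrite /= -nth_last size_ordering. Qed.

Lemma head_ordering : head 0 m = nth 0 (1 :: m) 1.
Proof. by rewrite /= nth0. Qed.

Lemma color_head : color (word m 1) = marked n (head 0 m).
Proof. by rewrite head_ordering color_word. Qed.

Lemma color_last_word : color (word m k.+1) = marked n (last 0 m).
Proof. by rewrite last_ordering color_word. Qed.

Lemma prefix_nested i j : nested (pre i) (pre j).
Proof.
wlog ij : i j / i <= j.
  by move=> H; case/orP: (leq_total i j) => /H //; rewrite nestedC.
apply/or3P; constructor 1; apply/subsetP=> x; rewrite !mem_prefix_set => /existsP[a e].
by apply/existsP; exists (widen_ord (ij : i < j.+1) a).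
Qed.

Lemma comb_face : comb N m \in K = ~~ marked n (head 0 m) && marked n (last 0 m).
Proof.
apply/idP/andP => [mK|[h1 h2]].
  have bic l : 0 < l <= k -> bicolored (pre l).
    move=> lk; have /(face_split mK)[_] : split (pre l) \in comb N m by apply/combP; exists l.
    by rewrite side_prefix //; case/andP: lk => _ /leqW.
  have k0 : 0 < k by clear -hd hn; lia.
  split.
    have /bic/and4P[_ _ /existsP[i /andP[ip c]] _] : 0 < 1 <= k by [].
    move: ip c; rewrite mem_prefix_set => /existsP[[[|[|//]] lt] /eqP-> /=] c.
      by rewrite word0 color_first in c.
    by rewrite color_head in c.
  have /bic/and4P[_ _ _ /existsP[i /andP[]]] : 0 < k <= k by rewrite k0 leqnn.
  rewrite inE => ik ci; rewrite -color_last_word.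
  have iz : i != z by apply: contraTneq ci => ->; exact: color_last.
  have [j jk ej] := word_onto iz.
  move: ik; rewrite ej word_in_prefix ?leqnSn // -ltnNge => kj.
  by have <- : j = k.+1 by [apply/eqP; rewrite eqn_leq -ltnS jk kj]; rewrite -ej.
apply: faceP => [P /combP[l /andP[l0 lk] ->]|P Q].
  exists (pre l) => //; have lk' := leqW lk.
  apply/and4P; split; first exact: last_notin_prefix.
  - by apply/existsP; exists o; rewrite color_first -word0 word_in_prefix.
  - by apply/existsP; exists (word m 1); rewrite color_head h1 word_in_prefix ?l0.
  - apply/existsP; exists (word m k.+1).
    by rewrite color_last_word h2 inE word_in_prefix // -ltnNge ltnS lk.
move=> /combP[i /andP[_ ik] ->] /combP[j /andP[_ jk] ->].
by rewrite !side_prefix ?leqW ?prefix_nested.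
Qed.

Lemma comb_sides : comb N m \in K ->
  [/\ uniq (map side (enum (comb N m))), size (map side (enum (comb N m))) = k,
      forall l, 0 < l <= k -> pre l \in map side (enum (comb N m))
    & {in map side (enum (comb N m)), forall A, exists2 l, 0 < l <= k & A = pre l}].
Proof.
move=> mK; split.
- rewrite map_inj_in_uniq ?enum_uniq // => P Q; rewrite !mem_enum; exact: side_inj mK _ _.
- by rewrite size_map -cardE card_comb.
- move=> l lk; rewrite -side_prefix; last by case/andP: lk => _ /leqW.
  by rewrite map_f // mem_enum; apply/combP; exists l.
- move=> A /mapP[P]; rewrite mem_enum => /combP[l lk ->] ->; exists l => //.
  by rewrite side_prefix //; case/andP: lk => _ /leqW.
Qed.

End Word.

(** * The cycle of an admissible word *)

Definition changes (m : seq nat) i :=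
  \sum_(j < i) (marked n (nth 0 m j) != marked n (nth 0 m j.+1)).

Definition block m (x : nat) := changes m (index x m).

(* The relabelings that permute the letters inside each maximal monochromatic
   run of the word m. *)
Definition block_perms (m : seq nat) : {set {perm 'I_N}} :=
  [set t : {perm 'I_N} | [&& t o == o, t z == z
    & [forall x, block m (label (t x)) == block m (label x)]]].

Section BlockPerm.
Variable m : seq nat.
Hypothesis hm : m \in inner_orderings d n.

Lemma block_word j : j < k.+1 -> block m (label (word m j.+1)) = changes m j.
Proof.
move=> jk; rewrite label_word //= /block index_uniq //; first by rewrite size_ordering.
by have /andP[] := uniq_ordering hm.
Qed.

Lemma changesS j : changes m j.+1 =
  changes m j + (marked n (nth 0 m j) != marked n (nth 0 m j.+1)).
Proof. by rewrite /changes big_ord_recr. Qed.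

Lemma color_changes j : j < k.+1 -> color (word m j.+1) = marked n (head 0 m) (+) odd (changes m j).
Proof.
elim: j => [|j IH] jk; first by rewrite color_head // /changes big_ord0 addbF.
have := IH (ltnW jk); rewrite !color_word //=; last exact: ltnW.
by rewrite changesS oddD oddb => ->; case: (marked n (nth 0 m j.+1)) (marked n (head 0 m)) (odd _) => [] [] [].
Qed.

Lemma word_inner x : x != o -> x != z -> exists2 j, j < k.+1 & x = word m j.+1.
Proof.
move=> xo xz; have [[|j] jk e] := word_onto hm xz; last by exists j.
by rewrite e word0 eqxx in xo.
Qed.

Lemma block_color x y : x != o -> x != z -> y != o -> y != z ->
  block m (label x) = block m (label y) -> color x = color y.
Proof.
move=> xo xz yo yz; have [i ik ->] := word_inner xo xz; have [j jk ->] := word_inner yo yz.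
by rewrite !block_word // !color_changes // => ->.
Qed.

Variable t : {perm 'I_N}.
Hypothesis ht : t \in block_perms m.

Lemma block_perm_first : t o = o.
Proof. by move: ht; rewrite inE => /and3P[/eqP]. Qed.

Lemma block_perm_last : t z = z.
Proof. by move: ht; rewrite inE => /and3P[_ /eqP]. Qed.

Lemma block_perm_block x : block m (label (t x)) = block m (label x).
Proof. by move: ht; rewrite inE => /and3P[_ _ /forallP/(_ x)/eqP]. Qed.

Lemma block_perm_eq_first x : (t x == o) = (x == o).
Proof. by rewrite -{1}block_perm_first (inj_eq perm_inj). Qed.

Lemma block_perm_eq_last x : (t x == z) = (x == z).
Proof. by rewrite -{1}block_perm_last (inj_eq perm_inj). Qed.

Lemma block_perm_color x : color (t x) = color x.
Proof.
have [->|xo] := eqVneq x o; first by rewrite block_perm_first.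
have [->|xz] := eqVneq x z; first by rewrite block_perm_last.
by apply: block_color; rewrite ?block_perm_eq_first ?block_perm_eq_last ?block_perm_block.
Qed.

Lemma block_word_inj : word_inj k (t \o word m).
Proof. by move=> i j ik jk /perm_inj; apply: word_word_inj. Qed.

End BlockPerm.

Local Open Scope ring_scope.

Definition word_det (W : nat -> 'I_N) (s : seq {set 'I_N}) : int :=
  rows_det (map (bracket_row k W) s).

Definition class_det m (s : seq {set 'I_N}) : int :=
  \sum_(t in block_perms m) (-1) ^+ odd_perm t * word_det (t \o word m) s.

Definition class_chain m : {ffun {set {set {set 'I_N}}} -> int} :=
  [ffun F => if (F \in K) && (#|F| == k) then class_det m (map side (enum F)) else 0].

Fact k_gt0 : (0 < k)%N. Proof. by clear -hd hn; lia. Qed.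

Section Vanishing.
Variables (m : seq nat).
Hypotheses (hm : m \in inner_orderings d n).
Hypotheses (mh : ~~ marked n (head 0%N m)) (ml : marked n (last 0%N m)).

Lemma tperm_mem (a b : 'I_N) B : (a \in B) = (b \in B) -> forall x, (tperm a b x \in B) = (x \in B).
Proof. by move=> e x; case: tpermP => [->|->|//]; rewrite e. Qed.

Lemma block_perms_tperm a b t : a != o -> b != o -> a != z -> b != z ->
  block m (label a) = block m (label b) ->
  (t * tperm a b \in block_perms m)%g = (t \in block_perms m).
Proof.
move=> ao bo az bz e.
have stab s : s \in block_perms m -> (s * tperm a b)%g \in block_perms m.
  rewrite !inE => /and3P[/eqP so /eqP sz /forallP sb].
  rewrite !permM so sz !tpermD // !eqxx /=; apply/forallP=> x; rewrite permM.
  have /eqP <- := sb x; apply/eqP.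
  by case: tpermP => [->|->|//].
apply/idP/idP => [/stab|/stab//].
by rewrite -mulgA tperm2 mulg1.
Qed.

Lemma class_det_swap a b (s : seq {set 'I_N}) : a != b -> a != o -> b != o -> a != z -> b != z ->
  block m (label a) = block m (label b) -> {in s, forall B, (a \in B) = (b \in B)} ->
  class_det m s = 0.
Proof.
move=> ab ao bo az bz e hs.
suff : class_det m s = - class_det m s by lia.
rewrite {1}/class_det (reindex_inj (mulIg (tperm a b))) /= -sumrN.
apply: eq_big => [t|t _]; first by rewrite block_perms_tperm.
rewrite odd_permM odd_tperm ab addbT signrN mulNr; congr (- (_ * rows_det _)).
apply/eq_in_map => B Bs; transitivity (bracket_row k (tperm a b \o (t \o word m)) B).
  by apply: bracket_row_ext => j _; rewrite /adj /= !permM.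
by apply: bracket_row_perm; exact: tperm_mem (hs B Bs).
Qed.

Lemma mono_class_det U (s : seq {set 'I_N}) : z \notin U -> {in U &, forall x y, color x = color y} ->
  {in s, forall B, U \subset B \/ [disjoint U & B]} -> class_det m (U :: s) = 0.
Proof.
move=> zU mU hs.
have [/existsP[a /existsP[b /and5P[aU bU ab ao /andP[bo /eqP e]]]]|no] :=
  boolP [exists a, exists b, [&& a \in U, b \in U, a != b, a != o &
    (b != o) && (block m (label a) == block m (label b))]].
  apply: (@class_det_swap a b) => //.
  - by apply: contraNneq zU => <-.
  - by apply: contraNneq zU => <-.
  move=> B; rewrite inE => /orP[/eqP->|/hs[/subsetP h|h]]; first by rewrite aU bU.
    by rewrite !h.
  by rewrite (disjointFr h aU) (disjointFr h bU).
rewrite /class_det big1 // => t tH; rewrite /word_det /= bracket_row0.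
  by rewrite rows_det_cons0 ?k_gt0 // mulr0.
move=> j jk; apply/negP => /andP[/= aU bU].
have jk1 : (j < k.+2)%N by apply: leqW.
have cab := mU _ _ aU bU; rewrite !(block_perm_color hm tH) in cab.
case: j jk jk1 => [|j] jk jk1 in aU bU cab *.
  by move: cab; rewrite word0 color_first color_head // (negPf mh).
case/negP: no; apply/existsP; exists (t (word m j.+1)); apply/existsP; exists (t (word m j.+2)).
rewrite aU bU !(block_perm_eq_first tH) !(block_perm_block tH) !block_word //.
have neq (i1 i2 : nat) : (i1 < k.+2)%N -> (i2 < k.+2)%N -> i1 != i2 -> word m i1 != word m i2.
  by move=> h1 h2; apply: contraNneq => /(word_word_inj hm) ->.
rewrite (inj_eq perm_inj) neq // -?(word0 m) ?neq //=; last by rewrite neq_ltn ltnSn.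
rewrite changesS; move: cab; rewrite !color_word //= => ->.
by rewrite eqxx addn0.
Qed.

Lemma mono_compl_class_det U (s : seq {set 'I_N}) x : x \notin U -> x != z -> ~~ color x ->
  {in s, forall B, B \subset U} -> class_det m (U :: s) = 0.
Proof.
move=> xU xz cx hs; rewrite /class_det big1 // => t tH.
have [||j jk ex] := @word_inner m hm ((t^-1)%g x).
  - rewrite -(block_perm_eq_first tH) permKV.
    by apply: contraNneq cx => ->; exact: color_first.
  - by rewrite -(block_perm_eq_last tH) permKV.
have {}ex : x = t (word m j.+1) by rewrite -ex permKV.
have jlt : (j < k)%N.
  move: jk; rewrite ltnS leq_eqVlt => /orP[/eqP jk|//].
  by move: cx; rewrite ex jk (block_perm_color hm tH) color_last_word // ml.
rewrite /word_det (rows_det_zero_col (j := Ordinal jlt)) ?mulr0 // => u /mapP[B Bs ->].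
have xB : x \notin B.
  by move: Bs; rewrite inE => /orP[/eqP->//|/hs/subsetP h]; apply: contra xU; exact: h.
by rewrite mxE /adj /= -ex (negPf xB) andbF.
Qed.

Lemma class_det_not_bicolored F U : F \in K -> z \notin U -> U != leaves -> ~~ bicolored U ->
  {in F, forall P, nested U (side P)} -> class_det m (U :: map side (enum F)) = 0.
Proof.
move=> FK zU Ul bU nU.
have sides B : B \in map side (enum F) -> bicolored B /\ nested U B.
  case/mapP=> P; rewrite mem_enum => PF ->.
  by have [_ b] := face_split FK PF; split=> //; apply: nU.
have mono c : {in U, forall x, color x = c} -> class_det m (U :: map side (enum F)) = 0.
  move=> mU; apply: mono_class_det => //; first by move=> x y xU yU; rewrite !mU.
  move=> B /sides[/and4P[_ /existsP[x /andP[xB cx]] /existsP[y /andP[yB cy]] _]].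
  case/or3P=> [|/subsetP h|]; [by left | | by right].
  by case/negP: cy; rewrite (mU y (h y yB)) -(mU x (h x xB)).
move: bU; rewrite /bicolored zU /= !negb_and => /or3P[h|h|h].
- apply: (mono false) => x xU; apply: contraNF h => cx.
  by apply/existsP; exists x; rewrite xU.
- apply: (mono true) => x xU; apply: contraNT h => cx.
  by apply/existsP; exists x; rewrite xU.
have cU x : color x -> x \in U.
  by move=> cx; apply: contraNT h => xU; apply/existsP; exists x; rewrite inE xU.
have [x xU xz] : exists2 x, x \notin U & x != z.
  have [e|[x]] := set_0Vmem (leaves :\: U); last by rewrite !inE => /andP[]; exists x.
  case/negP: Ul; rewrite eqEsubset -[leaves \subset U]setD_eq0 e eqxx andbT.
  by rewrite subsetC sub1set inE.
have cx : ~~ color x by apply: contra xU; exact: cU.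
apply: (mono_compl_class_det xU xz cx) => B /sides[/and4P[_ e1 _ e3]].
case/or3P=> [/subsetP hUB|//|hd'].
  case/existsP: e3 => y; rewrite inE => /andP[yB cy].
  by rewrite (hUB y (cU y cy)) in yB.
case/existsP: e1 => y /andP[yB cy].
by rewrite (disjointFr hd' (cU y cy)) in yB.
Qed.

End Vanishing.

Lemma class_det_boundary m F v : v \notin F -> (#|F|.+1 = k)%N ->
  (-1) ^+ face_index F v * class_det m (map side (enum (v |: F))) =
  class_det m (side v :: map side (enum F)).
Proof.
move=> vF cF; rewrite /class_det mulr_sumr; apply: eq_bigr => t _.
rewrite mulrCA; congr (_ * _); rewrite /word_det -map_comp boundary_rows_det //=.
by rewrite -map_comp.
Qed.

Section FlipRelation.
Variables (T : {set {set {set 'I_N}}}) (v : {set {set 'I_N}}) (A B C : {set 'I_N}).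
Hypotheses (TK : T \in K) (cT : #|T| = k) (vT : v \in T).
Hypothesis fl : flip_data (family T) (side v) A B C.
Let s := map side (enum (T :\ v)).

Lemma size_sides : (size s < k)%N.
Proof. by rewrite size_map -cardE -cT (cardsD1 v T) vT. Qed.

Lemma word_det_node (W : nat -> 'I_N) X : word_inj k W ->
  (forall j, (j < k.+2)%N -> W j != z) -> node (family T) X -> X != side v ->
  word_det W (X :: s) = 0.
Proof.
move=> injW Wz nX Xv; rewrite /word_det /=.
case/orP: nX => [XT|/eqP X1]; last by rewrite bracket_row1 // rows_det_cons0 ?k_gt0.
have : X \in family T :\ side v by rewrite in_setD1 Xv.
case/(family_del TK vT) => [->|[P PT ->]].
  rewrite bracket_row_full ?rows_det_cons0 ?k_gt0 // => j jk.
  by rewrite !inE Wz.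
by rewrite rows_det_cons_mem ?size_map -?(size_map side) ?size_sides // !map_f ?mem_enum.
Qed.

Lemma class_det_flip m : m \in inner_orderings d n ->
  class_det m (side v :: s) + class_det m ((A :|: B) :: s) + class_det m ((A :|: C) :: s) = 0.
Proof.
move=> hm; rewrite /class_det -!big_split /= big1 // => t tH.
rewrite -!mulrDr; set W := t \o word m.
have injW : word_inj k W by exact: block_word_inj.
have Wz j : (j < k.+2)%N -> W j != z.
  by move=> jk; rewrite /W /= (block_perm_eq_last tH) word_neq_last.
have [Av Bv Cv Xv] := flip_data_neq (family_laminar TK) fl.
have [ev /and3P[nA nB nC] XG dAv dBC] := fl.
have [dAB dAC] : [disjoint A & B] /\ [disjoint A & C].
  by split; apply: disjointWr dAv; rewrite ev ?subsetUl ?subsetUr.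
have := congr1 (fun r => rows_det (r :: map (bracket_row k W) s))
  (@bracket_row_flip _ k W A B C dAB dAC dBC).
rewrite !rows_det_consD ?k_gt0 // -setUA -ev.
have n0 X := @word_det_node W X injW Wz.
rewrite -[rows_det (bracket_row _ _ (A :|: side v) :: _)]/(word_det W ((A :|: side v) :: s)).
rewrite -[rows_det (bracket_row _ _ A :: _)]/(word_det W (A :: s)).
rewrite -[rows_det (bracket_row _ _ B :: _)]/(word_det W (B :: s)).
rewrite -[rows_det (bracket_row _ _ C :: _)]/(word_det W (C :: s)).
have nX : node (family T) (A :|: side v) by rewrite /node XG.
rewrite (n0 _ nX Xv) (n0 _ nA Av) (n0 _ nB Bv) (n0 _ nC Cv) !addr0 => e.
rewrite [X in _ * X](_ : _ = 0) ?mulr0 // -e /word_det /=.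
by rewrite [RHS]addrC addrA.
Qed.

End FlipRelation.

Lemma class_cycle m : m \in inner_orderings d n -> ~~ marked n (head 0%N m) ->
  marked n (last 0%N m) -> cycle_pred K k (class_chain m).
Proof.
move=> hm mh ml; apply/andP; split.
  by apply/forallP=> F; rewrite ffunE; case: ifP => // _; rewrite implybT.
apply/eqP/ffunP=> F; rewrite !ffunE.
have [/existsP[v0 /and3P[v0F v0K /eqP cT]]|no] :=
  boolP [exists v, [&& v \notin F, v |: F \in K & #|v |: F| == k]]; last first.
  apply: big1 => v vF; rewrite ffunE; case: ifP; last by rewrite mulr0.
  by move=> vK; case/negP: no; apply/existsP; exists v; rewrite vF.
set T := v0 |: F in v0K cT.
have v0T : v0 \in T by rewrite setU11.
have eF : T :\ v0 = F by rewrite setU1K.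
have cF : (#|F|.+1 = k)%N by rewrite -cT /T cardsU1 v0F.
have FK : F \in K by apply: face_sub v0K; rewrite subsetUr.
have [v0G v0l] := side_in_family v0K v0T.
have lam := family_laminar v0K; have mx := family_max v0K cT.
have [A [B [C fl]]] := flip_data_ex lam mx (setU11 _ _) v0G v0l.
have fl' := flip_data_sym fl.
have key X Y Z : flip_data (family T) (side v0) X Y Z ->
    [/\ z \notin X :|: Y, split (X :|: Y) \notin F & 
        split (X :|: Y) |: F \in K \/ class_det m ((X :|: Y) :: map side (enum F)) = 0].
  move=> fl1; have [ev _ XG _ _] := fl1.
  have nn := flip_not_nested lam fl1.
  have zXY : z \notin X :|: Y.
    have /andP[sX _] := lam.1 _ XG.
    apply/negP => zin; have : z \in leaves.
      by apply: (subsetP sX); move: zin; rewrite ev !inE => /orP[]->; rewrite ?orbT.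
    by rewrite !inE eqxx.
  have nF P : P \in F -> nested (X :|: Y) (side P).
    move=> PF; apply: (flip_nested lam fl1); rewrite ?v0G //.
      by rewrite !inE imset_f ?orbT // inE PF orbT.
    apply: contraNneq v0F => e; rewrite -(side_inj v0K _ _ e) //.
    by rewrite inE PF orbT.
  split=> //.
    apply: contra nn => h; have := face_nested v0K (setU1r v0 h) v0T.
    by rewrite side_split.
  have [bXY|nb] := boolP (bicolored (X :|: Y)); [left; exact: face_add | right].
  apply: class_det_not_bicolored => //.
  apply: contraNneq nn => ->; have [_ b] := face_split v0K v0T.
  by rewrite /nested bicolored_leaves ?orbT.
have [zAB ABF ABor] := key _ _ _ fl; have [zAC ACF ACor] := key _ _ _ fl'.
have nn := flip_not_nested lam fl; have nn' := flip_not_nested lam fl'.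
have zv : z \notin side v0 by have [_ /bicolored_last] := face_split v0K v0T.
have uq : uniq [:: v0; split (A :|: B); split (A :|: C)].
  rewrite /= !inE !negb_or !andbT -andbA; apply/and3P; split.
  - by apply: contraNneq nn => e; rewrite e side_split // /nested subxx.
  - by apply: contraNneq nn' => e; rewrite e side_split // /nested subxx.
  - apply/negP => /eqP/(congr1 side); rewrite !side_split // => e.
    have [ev /and3P[nA nB nC] XG dAv dBC] := fl.
    have /card_gt0P[b bB] := node_gt0 lam nB.
    have /setP/(_ b) := e; rewrite !inE bB orbT (disjointFr dBC bB) orbF => /esym bA.
    by have := disjointFr dAv bA; rewrite ev inE bB.
have e0 := class_det_flip v0K cT v0T fl hm; rewrite eF in e0.
transitivity (\sum_(v <- [:: v0; split (A :|: B); split (A :|: C)])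
  class_det m (side v :: map side (enum F))); last first.
  by rewrite !big_cons big_nil (side_split zAB) (side_split zAC) -[RHS]e0 addr0 addrA.
rewrite [RHS]big_uniq // [LHS]big_mkcond [RHS]big_mkcond; apply: eq_bigr => v _.
have [vs|vs] := boolP (v \in [:: v0; split (A :|: B); split (A :|: C)]).
  have vF : v \notin F by move: vs; rewrite !inE => /or3P[]/eqP->.
  rewrite vF ffunE cardsU1 vF add1n cF eqxx andbT; case: ifP => vK.
    by rewrite class_det_boundary.
  rewrite mulr0; move: vs; rewrite !inE => /or3P[]/eqP ev; move: vK; rewrite ev.
  - by rewrite -/T v0K.
  - by case: ABor => [->//|h] _; rewrite side_split // h.
  - by case: ACor => [->//|h] _; rewrite side_split // h.
case: ifP => // vF; rewrite ffunE; case: ifP; last by rewrite mulr0.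
case/andP=> vK _; case/negP: vs; rewrite !inE.
have := @face_flip_only T v0 v A B C v0K cT v0T fl; rewrite eF => /(_ vF vK).
by case=> ->; rewrite eqxx ?orbT.
Qed.

Definition block_lt m : rel nat :=
  fun x y => (block m x < block m y)%N || (block m x == block m y) && (x < y)%N.

Lemma block_lt_sorted m m' : m \in inner_orderings d n -> m' \in inner_orderings d n ->
  sorted (color_increasing n) m' ->
  (forall j, (j < k.+1)%N -> block m (nth 0%N m' j) = changes m j) ->
  (forall j, (j < k.+1)%N -> marked n (nth 0%N m' j) = marked n (nth 0%N m j)) ->
  sorted (block_lt m) m'.
Proof.
move=> hm hm' sm' eb ec; apply/(sortedP 0%N) => j; rewrite size_ordering // => jk.
rewrite /block_lt !eb ?(ltnW jk) // changesS -!ec ?(ltnW jk) //.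
have : (j.+1 < size m')%N by rewrite size_ordering.
move/(sortedP 0%N sm' j); rewrite /color_increasing.
by case: eqP => /= _; [rewrite addn0 eqxx ltnn | rewrite addn1 ltnSn].
Qed.

Lemma block_perm_word_eq m m' (t : {perm 'I_N}) :
  m \in inner_orderings d n -> m' \in inner_orderings d n -> admissible n m -> admissible n m' ->
  t \in block_perms m -> (forall j, (j <= k)%N -> t (word m j) = word m' j) -> m = m' /\ t = 1%g.
Proof.
move=> hm hm' /and3P[_ _ sm] /and3P[_ _ sm'] tH ag.
have ag' j : (j < k.+2)%N -> t (word m j) = word m' j.
  rewrite ltnS leq_eqVlt => /orP[/eqP->|]; last by rewrite ltnS => /ag.
  have [|i ik e] := @word_onto m' hm' (t (word m k.+1)).
    by rewrite (block_perm_eq_last tH) word_neq_last.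
  move: ik; rewrite ltnS leq_eqVlt => /orP[/eqP ik|ik]; first by rewrite e ik.
  move: e; rewrite -(ag i ik) => /perm_inj/(word_word_inj hm).
  by rewrite !inE => e; have := e (leqnn _) (leqW ik) => ek; rewrite ek ltnn in ik.
have lab' j : (j < k.+1)%N -> nth 0%N m' j = label (t (word m j.+1)).
  by move=> jk; rewrite ag' // label_word.
have e : m = m'.
  apply: (@irr_sorted_eq _ (block_lt m)).
  - by move=> y x w; rewrite /block_lt; clear; lia.
  - by move=> x; rewrite /block_lt; clear; lia.
  - apply: block_lt_sorted => // j jk.
    by rewrite -(block_word hm jk) label_word.
  - apply: block_lt_sorted => // j jk; rewrite lab' //.
      by rewrite (block_perm_block tH) block_word.
    rewrite -[marked n (label _)]/(color _) (block_perm_color hm tH) color_word //.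
  - by move=> x; rewrite !mem_ordering.
split=> //; apply/permP=> x; rewrite perm1.
have [->|/(word_onto hm)[j jk ->]] := eqVneq x z; first exact: block_perm_last tH.
by rewrite ag' // -e.
Qed.

Section Evaluation.
Variables m m' : seq nat.
Hypotheses (hm : m \in inner_orderings d n) (hm' : m' \in inner_orderings d n).
Hypotheses (am : admissible n m) (am' : admissible n m').

Lemma admissible_face : comb N m' \in K.
Proof. by case/and3P: am' => h1 h2 _; rewrite comb_face // h1. Qed.

Lemma comb_word_det (t : {perm 'I_N}) : t \in block_perms m ->
  word_det (t \o word m) (map side (enum (comb N m'))) != 0 -> m = m' /\ t = 1%g.
Proof.
move=> tH nz; have [us ss s1 s2] := comb_sides hm' admissible_face.
apply: (block_perm_word_eq hm hm' am am' tH) => j jk.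
apply: (comb_det_neq0 _ _ _ ss s1 nz) => //; try exact: word_word_inj.
- exact: block_word_inj.
- by rewrite /= !word0 (block_perm_first tH).
Qed.

Lemma class_chain_comb : class_chain m (comb N m') =
  if m == m' then word_det (word m) (map side (enum (comb N m'))) else 0.
Proof.
rewrite ffunE admissible_face card_comb // eqxx /class_det.
have H1 : (1 : {perm 'I_N})%g \in block_perms m.
  by rewrite inE !perm1 !eqxx; apply/forallP=> x; rewrite perm1.
set s := map side _.
have e1 : word_det ((1 : {perm 'I_N})%g \o word m) s = word_det (word m) s.
  congr rows_det; apply: eq_map => B; apply: bracket_row_ext => j _.
  by rewrite /adj /= !perm1.
rewrite (bigD1 _ H1) /= big1 => [|t /andP[tH t1]].
  rewrite odd_perm1 expr0 mul1r addr0 e1.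
  case: eqVneq => // ne; apply/eqP; apply: contraNT ne => nz.
  by have [|-> _] := comb_word_det H1; rewrite ?e1.
have [->|/(comb_word_det tH)[_ e]] := eqVneq (word_det (t \o word m) s) 0.
  by rewrite mulr0.
by rewrite e eqxx in t1.
Qed.

End Evaluation.

Lemma class_chain_sq m : m \in inner_orderings d n -> admissible n m ->
  class_chain m (comb N m) ^+ 2 = 1.
Proof.
move=> hm am; rewrite class_chain_comb // eqxx.
have [us ss s1 s2] := comb_sides hm (admissible_face hm am).
by apply: comb_det_sq => //; exact: word_word_inj.
Qed.

Lemma comb_inj m m' : m \in inner_orderings d n -> m' \in inner_orderings d n ->
  admissible n m -> admissible n m' -> comb N m = comb N m' -> m = m'.
Proof.
move=> hm hm' am am' e; have := class_chain_sq hm am.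
by rewrite e class_chain_comb //; case: eqP.
Qed.

(** * Flips between combs *)

Lemma unsorted_split (T : eqType) (r : rel T) (s : seq T) : ~~ sorted r s ->
  exists s1 a b s2, s = s1 ++ a :: b :: s2 /\ ~~ r a b.
Proof.
elim: s => [//|a [//|b s] IH] /=; rewrite negb_and => /orP[rab|/IH].
  by exists [::], a, b, s.
by case=> s1 [a' [b' [s2 [e r']]]]; exists (a :: s1), a', b', s2; rewrite e.
Qed.

Fixpoint weight (s : seq nat) : nat := if s is x :: s' then (size s * x + weight s')%N else 0%N.

Lemma weight_swap s1 a b s2 : (b < a)%N ->
  (weight (s1 ++ b :: a :: s2) < weight (s1 ++ a :: b :: s2))%N.
Proof.
move=> ba; elim: s1 => [|x s1 IH] /=; first by nia.
by rewrite !size_cat /= ltn_add2l.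
Qed.

Lemma mem_prefix_take m l x : m \in inner_orderings d n -> (l <= k.+1)%N ->
  (x \in prefix_set (word m) l) = (label x \in 1%N :: take l m).
Proof.
move=> hm lk; have -> : 1%N :: take l m = take l.+1 (1%N :: m) by [].
have um := uniq_ordering hm; have sz : size (1%N :: m) = k.+2 by rewrite /= size_ordering.
have [->|/(word_onto hm)[j jk ->]] := eqVneq x z.
  rewrite (negPf (last_notin_prefix hm lk)); apply/esym/negP => /mem_take.
  by rewrite label_last inE mem_ordering // ltnn andbF orbF; have := k_gt0; clear; lia.
rewrite word_in_prefix // label_word // in_take ?mem_nth ?sz //.
by rewrite index_uniq ?sz.
Qed.

Section Swap.
Variables (s1 s2 : seq nat) (a b : nat).
Let m := s1 ++ a :: b :: s2.
Let m' := s1 ++ b :: a :: s2.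
Hypotheses (hm : m \in inner_orderings d n) (hab : marked n a = marked n b).
Let l := (size s1).+1.

Lemma swap_ordering : m' \in inner_orderings d n.
Proof.
rewrite mem_permutations; apply: perm_trans (ordering_perm hm).
by rewrite /m /m' perm_cat2l (perm_cat2r s2 [:: b; a] [:: a; b]) (perm_catC [:: b] [:: a]).
Qed.

Lemma swap_pos : (0 < l <= k)%N.
Proof.
by have := size_ordering hm; rewrite /m size_cat /= /l => e; rewrite -ltnS -e; clear; lia.
Qed.

Lemma word_swap_pos : word m l = leaf a /\ word m l.+1 = leaf b.
Proof.
by rewrite /word /= /m !nth_cat ltnn subnn [(_.+1 < _)%N]ltnNge leqnSn subSnn.
Qed.

Lemma swap_prefix i : (i <= k.+1)%N -> i != l ->
  prefix_set (word m') i = prefix_set (word m) i.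
Proof.
move=> ik il; apply/setP=> x; rewrite !mem_prefix_take ?swap_ordering //.
rewrite !inE; congr (_ || _); rewrite /m /m' !take_cat.
case: ltnP => // h; rewrite !mem_cat; congr (_ || _).
move: il; rewrite /l; case: (i - size s1)%N (subnKC h) => [|[|p]] e //=.
  by rewrite -e addn1 eqxx.
by rewrite !inE orbCA.
Qed.

Lemma swap_prefix_pos : prefix_set (word m') l = leaf b |: prefix_set (word m) l.-1.
Proof.
have /andP[_ lk] := swap_pos; have hm' := swap_ordering.
have bN : (0 < b <= N)%N.
  have : b \in m by rewrite /m mem_cat !inE eqxx !orbT.
  by rewrite (mem_ordering hm); clear; lia.
apply/setP=> x; rewrite in_setU1 !mem_prefix_take //; try by clear -lk; lia.
have -> : take l m' = rcons s1 b by rewrite /m' -cat_rcons take_size_cat ?size_rcons.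
have -> : take l.-1 m = s1 by rewrite /m take_size_cat.
rewrite !in_cons mem_rcons in_cons orbCA; congr (_ || _).
apply/eqP/eqP => [e|->]; last exact: leafK.
by rewrite -e labelK.
Qed.

Lemma swap_flip : flip_data (family (comb N m)) (prefix_set (word m) l)
  [set leaf b] (prefix_set (word m) l.-1) [set leaf a].
Proof.
have /andP[l0 lk] := swap_pos; have [wa wb] := word_swap_pos.
have mem i : (i < k)%N -> prefix_set (word m) i.+1 \in family (comb N m).
  move=> ik; rewrite in_setU1; apply/orP; right; apply/imsetP.
  exists (split (prefix_set (word m) i.+1)); last by rewrite side_prefix // leqW.
  by apply/combP => //; exists i.+1.
have preS i : (i <= k)%N -> prefix_set (word m) i.+1 = word m i.+1 |: prefix_set (word m) i.
  move=> ik; apply/setP=> x; rewrite in_setU1.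
  have [->|/(word_onto hm)[j jk ->]] := eqVneq x z.
    rewrite !(negPf (last_notin_prefix hm _)) ?orbF //; last by clear -ik; lia.
    by rewrite eq_sym (negPf (word_neq_last hm _)).
  rewrite !word_in_prefix //; last by clear -ik; lia.
  rewrite leq_eqVlt ltnS; congr (_ || _); apply/eqP/eqP => [->//|].
  by apply: (word_word_inj hm); rewrite inE.
split.
- by rewrite -wa setUC; exact: (preS l.-1 (ltnW lk)).
- suff nB : node (family (comb N m)) (prefix_set (word m) l.-1).
    by rewrite nB /node !cards1 !eqxx !orbT.
  case: l.-1 (lk : (l.-1 < k)%N) => [_|i /ltnW ik]; last by rewrite /node mem.
  rewrite /node /prefix_set card_imset ?card_ord ?orbT // => i j _.
  by rewrite [i]ord1 [j]ord1.
- rewrite -wb -preS // in_setU1.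
  have [e|ne] := eqVneq l k; last by rewrite -in_setU1 mem // ltn_neqAle ne.
  apply/orP; left; apply/eqP/setP=> x; rewrite [in RHS]inE in_set1.
  have [->|/(word_onto hm)[j jk ->]] := eqVneq x z.
    by rewrite (negPf (last_notin_prefix hm _)) // e.
  by rewrite word_in_prefix // e // -ltnS jk.
- by rewrite disjoints1 -wb word_in_prefix // ?ltnn // leqW.
- rewrite disjoint_sym disjoints1 -wa word_in_prefix //; last 2 first.
  + by clear -lk; lia.
  + by rewrite ltnW.
  by rewrite -ltnNge prednK.
Qed.

Lemma swap_comb u : comb N m \in K ->
  u \notin comb N m :\ split (prefix_set (word m) l) ->
  u != split (prefix_set (word m) l) ->
  u |: (comb N m :\ split (prefix_set (word m) l)) \in K ->
  u |: (comb N m :\ split (prefix_set (word m) l)) = comb N m'.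
Proof.
move=> mK uT uv uK; have /andP[l0 lk] := swap_pos; have hm' := swap_ordering.
have vT : split (prefix_set (word m) l) \in comb N m by apply/combP => //; exists l; rewrite ?swap_pos.
have fl := swap_flip; rewrite -(side_prefix hm) in fl; last exact: leqW.
have [] := face_flip_only mK (card_comb hm) vT fl uT uK.
- by move=> e; rewrite e eqxx in uv.
- rewrite -swap_prefix_pos => eu; apply/eqP; rewrite eqEcard.
  apply/andP; split; last first.
    rewrite card_comb // cardsU1 uT.
    by have := cardsD1 (split (prefix_set (word m) l)) (comb N m); rewrite vT card_comb // => ->.
  apply/subsetP=> P; rewrite in_setU1 in_setD1 => /orP[/eqP->|/andP[Pv /(combP hm)[i ik eP]]].
    by rewrite eu; apply/combP => //; exists l; rewrite ?swap_pos.
  apply/combP => //; exists i => //; rewrite swap_prefix //; first by clear -ik; lia.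
  by apply: contraNneq Pv => <-; rewrite eP.
- move=> eu; have [_] := face_split uK (setU11 _ _).
  have mem x : x \in m -> color (leaf x) = marked n x.
    by rewrite (mem_ordering hm) /color => h; rewrite leafK //; clear -h; lia.
  have [am bm] : a \in m /\ b \in m by rewrite /m !mem_cat !inE !eqxx !orbT.
  have zU : z \notin [set leaf b] :|: [set leaf a].
    have [<- <-] := word_swap_pos; rewrite !inE !negb_or ![z == _]eq_sym !word_neq_last //.
    exact: leqW.
  rewrite eu side_split // => /and4P[_ /existsP[x /andP[xU cx]] /existsP[y /andP[yU cy]] _].
  by move: xU yU cx cy; rewrite !inE => /orP[]/eqP-> /orP[]/eqP->; rewrite !mem // ?hab => ->.
Qed.

End Swap.

Section Injectivity.
Variable c : {ffun {set {set {set 'I_N}}} -> int}.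
Hypothesis hc : cycle_pred K k c.
Hypothesis c0 : forall m, m \in inner_orderings d n -> admissible n m -> c (comb N m) = 0.

Lemma cycle_support F : c F != 0 -> F \in K /\ #|F| = k.
Proof. by case/andP: hc => /forallP/(_ F)/implyP h _ /h /andP[FK /eqP]. Qed.

Lemma cycle_outside F : F \notin K -> c F = 0.
Proof. by move=> FK; apply/eqP; apply: contraNT FK => /cycle_support[]. Qed.

Lemma cycle_comb0 m : m \in inner_orderings d n -> c (comb N m) = 0.
Proof.
have [w] := ubnP (weight m); elim: w m => // w IH m; rewrite ltnS => wm hm.
have [mK|/cycle_outside//] := boolP (comb N m \in K).
have [sm|/unsorted_split[s1 [a [b [s2 [em]]]]]] := boolP (sorted (color_increasing n) m).
  by apply: c0 => //; move: mK; rewrite comb_face // => /andP[h1 h2]; apply/and3P.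
rewrite negb_imply -leqNgt => /andP[/eqP hab ba].
rewrite em in hm mK wm *.
have ltba : (b < a)%N.
  rewrite ltn_neqAle ba andbT; apply/eqP=> e.
  have : uniq (s1 ++ a :: b :: s2) by case/andP: (uniq_ordering hm).
  by rewrite e cat_uniq /= inE eqxx !andbF.
have /andP[_ /eqP bc] := hc.
apply: (cycle_flip0 (v := split (prefix_set (word (s1 ++ a :: b :: s2)) (size s1).+1)) bc).
  by apply/combP => //; exists (size s1).+1; rewrite ?(swap_pos hm).
move=> u uT uv; apply/eqP; apply: contraT => /[dup] /cycle_support[uK _].
rewrite (swap_comb hm hab mK uT uv uK) IH ?eqxx //; last exact: swap_ordering.
by apply: leq_trans wm; exact: weight_swap.
Qed.

Lemma chain_face_comb T : T \in K -> #|T| = k -> (forall P, P \in T -> o \in side P) ->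
  exists2 m, m \in inner_orderings d n & T = comb N m.
Proof.
move=> TK cT oT.
pose rk (x : 'I_N) := #|[set P in T | x \notin side P]|.
pose r : rel nat := fun a b => (rk (leaf a) <= rk (leaf b))%N.
have r_total : total r by move=> a b; exact: leq_total.
pose m := sort r (iota 2 (N - 2)).
have hm : m \in inner_orderings d n by rewrite mem_permutations /m perm_sort.
have sm : sorted r m by exact: sort_sorted.
exists m => //; apply/eqP; rewrite eqEcard card_comb // cT leqnn andbT.
apply/subsetP=> P PT; have [eP bP] := face_split TK PT.
set A := side P in eP bP.
have down x y : x \in A -> (rk y <= rk x)%N -> y \in A.
  move=> xA; apply: contraTT => yA; rewrite -ltnNge; apply: proper_card.
  apply/properP; split; last first.
    by exists P; rewrite inE PT -/A ?xA ?yA.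
  apply/subsetP=> Q; rewrite inE => /andP[QT xQ]; rewrite inE QT /=.
  apply: contra yA => yQ.
  case: (nested_meet (face_nested TK PT QT) (oT P PT) (oT Q QT)) => /subsetP h; last exact: h.
  by rewrite h in xQ.
pose l := find (fun a => leaf a \notin A) m.
have inA j : (j < k.+1)%N -> (leaf (nth 0%N m j) \in A) = (j < l)%N.
  move=> jk; have [jl|lj] := ltnP j l.
    by have := before_find 0%N jl => /negbFE.
  apply/negP => jA.
  have hl : has (fun a => leaf a \notin A) m.
    by rewrite has_find size_ordering //; exact: leq_ltn_trans lj jk.
  have := nth_find 0%N hl; rewrite -/l => /negP; apply.
  apply: down jA _.
  apply: (@sorted_leq_nth _ r) => //; rewrite ?inE ?size_ordering //.
  - by move=> x y w; exact: leq_trans.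
  - by move=> x; exact: leqnn.
  - exact: leq_ltn_trans lj jk.
have l_gt0 : (0 < l)%N.
  have /card_gt1P[x [y [xA yA xy]]] := bicolored_gt1 bP.
  have [w wA wo] : exists2 w, w \in A & w != o.
    have [e|xo] := eqVneq x o; last by exists x.
    by exists y => //; rewrite -e eq_sym.
  have wz : w != z by apply: contraTneq wA => ->; exact: bicolored_last.
  have [j jk ew] := word_inner hm wo wz.
  have := inA j jk; rewrite -[leaf _]/(word m j.+1) -ew wA => /esym jl.
  exact: leq_ltn_trans (leq0n _) jl.
have lk : (l <= k)%N.
  have /and4P[_ _ _ /existsP[w]] := bP; rewrite inE => /andP[wA cw].
  have wz : w != z by apply: contraTneq cw => ->; exact: color_last.
  have wo : w != o by apply: contraNneq wA => ->; exact: oT.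
  have [j jk ew] := word_inner hm wo wz.
  have := inA j jk; rewrite -[leaf _]/(word m j.+1) -ew (negPf wA) => /esym/negbT.
  by rewrite -leqNgt => /leq_trans -> //.
apply/combP => //; exists l; first by rewrite l_gt0.
rewrite eP; congr split; apply/setP=> x.
have [->|/(word_onto hm)[j jk ->]] := eqVneq x z.
  by rewrite (negPf (bicolored_last bP)) (negPf (last_notin_prefix hm (leqW lk))).
rewrite (word_in_prefix hm (leqW lk) jk); case: j jk => [|j] jk; first by rewrite word0 oT.
by rewrite [word m _]/(leaf _) inA.
Qed.

Lemma cycle_eq0 : c = 0.
Proof.
apply/ffunP=> T; rewrite ffunE.
pose q T := #|[set P in T | o \notin side P]|.
have [w] := ubnP (q T); elim: w T => // w IH T; rewrite ltnS => qT.
apply/eqP; apply: contraT => /[dup] nz /cycle_support[TK cT]; case/eqP: nz.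
have [q0|q_gt0] := posnP (q T).
  have [|m hm ->] := chain_face_comb TK cT; last exact: cycle_comb0.
  move=> P PT; apply: contraT => oP.
  have : P \in [set P in T | o \notin side P] by rewrite inE PT.
  by rewrite (cards0_eq q0) inE.
have /card_gt0P[v1 v1Q] := q_gt0.
case: (arg_maxnP (fun P => #|side P|) v1Q) => v vQ vmax.
have : v \in [set P in T | o \notin side P] by [].
rewrite inE => /andP[vT ov].
have [vG vl] := side_in_family TK vT.
have lam := family_laminar TK; have mx := family_max TK cT.
have [A [B [C fl]]] := flip_data_ex lam mx (setU11 _ _) vG vl.
have [ev _ XG dAv _] := fl; have [_ _ _ Xv] := flip_data_neq lam fl.
have oA : o \in A.
  suff : o \in A :|: side v by rewrite in_setU (negPf ov) orbF.
  case/setU1P: XG => [->|/imsetP[P PT eX]].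
    by rewrite !inE; apply: contraTneq color_first => ->; exact: color_last.
  rewrite eX; apply: contraT => oP.
  have PQ : P \in [set P in T | o \notin side P] by rewrite inE PT.
  have := vmax P PQ; rewrite /= leqNgt -eX.
  by rewrite proper_card // properEneq eq_sym Xv subsetUr.
have /andP[_ /eqP bc] := hc.
apply: (cycle_flip0 bc vT) => u uT uv.
have [uK|/cycle_outside//] := boolP (u |: (T :\ v) \in K).
apply: IH; apply: leq_trans qT; apply: proper_card; apply/properP; split; last first.
  exists v; first by rewrite inE vT.
  by rewrite inE in_setU1 in_setD1 eqxx orbF eq_sym (negPf uv).
have [_ bu] := face_split uK (setU11 _ _).
have ou : o \in side u.
  have zX : z \notin A :|: side v.
    have /andP[sX _] := lam.1 _ XG; apply/negP => /(subsetP sX).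
    by rewrite !inE eqxx.
  move: zX; rewrite in_setU ev in_setU !negb_or => /and3P[zA zB zC].
  case: (face_flip_only TK cT vT fl uT uK) => [e|->|->]; first by rewrite e eqxx in uv.
  - by rewrite side_split in_setU ?oA // negb_or zA.
  - by rewrite side_split in_setU ?oA // negb_or zA.
apply/subsetP=> P; rewrite inE in_setU1 in_setD1.
by case/andP=> /orP[/eqP->|/andP[_ PT]] oP; [rewrite ou in oP | rewrite inE PT].
Qed.

End Injectivity.

(** * The isomorphism *)

Lemma max_face : \max_(F in K) #|F| = k.
Proof.
apply/eqP; rewrite eqn_leq; apply/andP; split.
  by apply/bigmax_leqP => F; exact: face_card.
pose m := iota n.+1 d.-1 ++ iota 2 n.-1.
have hm : m \in inner_orderings d n.
  rewrite mem_permutations /m perm_catC.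
  have -> : (N - 2 = n.-1 + d.-1)%N by clear -hd hn; lia.
  have e : n.+1 = (2 + n.-1)%N by clear -hn; lia.
  by rewrite iotaD -e.
rewrite -(card_comb hm); apply: leq_bigmax_cond.
rewrite comb_face // /m last_cat.
have -> y : last y (iota 2 n.-1) = n.
  by rewrite -nth_last size_iota nth_iota; clear -hn; lia.
have -> : d.-1 = d.-2.+1 by clear -hd; lia.
by rewrite /= /marked; clear -hn; lia.
Qed.

Definition admissible_orderings : seq (seq nat) := [seq m <- inner_orderings d n | admissible n m].

Lemma size_admissible_orderings : size admissible_orderings = num_orderings d n.
Proof. by rewrite size_filter. Qed.

Lemma admissible_orderingsP m : m \in admissible_orderings -> m \in inner_orderings d n /\ admissible n m.
Proof. by rewrite mem_filter => /andP[]. Qed.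

Lemma uniq_admissible_orderings : uniq admissible_orderings.
Proof. by rewrite filter_uniq // permutations_uniq. Qed.

Lemma nth_admissible_orderings (i : 'I_(num_orderings d n)) : nth [::] admissible_orderings i \in admissible_orderings.
Proof. by rewrite mem_nth // size_admissible_orderings. Qed.

Definition comb_values (c : cycles K k) : 'rV[int]_(num_orderings d n) :=
  \row_i cycle_val c (comb N (nth [::] admissible_orderings i)).

Lemma comb_values_zmod : zmod_morphism comb_values.
Proof. by move=> x y; apply/rowP=> i; rewrite !mxE /= !ffunE. Qed.

HB.instance Definition _ :=
  GRing.isZmodMorphism.Build (cycles K k) 'rV[int]_(num_orderings d n)
    comb_values comb_values_zmod.

Lemma comb_values_inj : injective comb_values.
Proof.
move=> x y e; apply/eqP; rewrite -subr_eq0; apply/eqP/val_inj.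
apply: cycle_eq0 => [|m hm am]; first exact: valP.
have mg : m \in admissible_orderings by rewrite mem_filter am.
have im : (index m admissible_orderings < num_orderings d n)%N by rewrite -size_admissible_orderings index_mem.
have : comb_values (x - y) 0 (Ordinal im) = 0 by rewrite raddfB /= e subrr mxE.
by rewrite mxE nth_index.
Qed.

Lemma admissible_class_cycle (i : 'I_(num_orderings d n)) : cycle_pred K k (class_chain (nth [::] admissible_orderings i)).
Proof.
by have [hm /and3P[h1 h2 _]] := admissible_orderingsP (nth_admissible_orderings i); exact: class_cycle.
Qed.

Definition basis_cycle i : cycles K k := Cycle (admissible_class_cycle i).

Lemma comb_values_basis i : comb_values (basis_cycle i) =
  class_chain (nth [::] admissible_orderings i) (comb N (nth [::] admissible_orderings i)) *: delta_mx 0 i.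
Proof.
apply/rowP=> j; rewrite !mxE eqxx /=.
have [[hi ai] [hj aj]] := (admissible_orderingsP (nth_admissible_orderings i), admissible_orderingsP (nth_admissible_orderings j)).
rewrite !class_chain_comb // eqxx nth_uniq ?size_admissible_orderings ?uniq_admissible_orderings //.
have [e|ne] := eqVneq j i; first by rewrite e eqxx mulr1.
by rewrite val_eqE eq_sym (negPf ne) mulr0.
Qed.

Lemma comb_values_bij : bijective comb_values.
Proof.
pose s i := class_chain (nth [::] admissible_orderings i) (comb N (nth [::] admissible_orderings i)).
pose h (r : 'rV[int]_(num_orderings d n)) := \sum_i basis_cycle i *~ (r 0 i * s i).
have hK : cancel h comb_values.
  move=> r; rewrite /h raddf_sum [RHS]row_sum_delta; apply: eq_bigr => i _.
  rewrite raddfMz /= comb_values_basis -scaler_int scalerA intz -mulrA -expr2.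
  have [hm am] := admissible_orderingsP (nth_admissible_orderings i).
  by rewrite class_chain_sq // mulr1.
by exists h => //; exact: inj_can_sym hK comb_values_inj.
Qed.

Lemma boundaries_eq0 : {in boundaries K k, forall x, x = 0}.
Proof.
move=> x /asboolP[c hc bc]; apply: val_inj; rewrite /= -bc.
have -> : c = 0.
  apply/ffunP=> F; rewrite ffunE; have /forallP/(_ F)/implyP h := hc.
  apply/eqP; apply: contraT => /h/andP[/face_card lt /eqP e].
  by rewrite e ltnn in lt.
exact: boundary0.
Qed.

Lemma top_homology_iso :
  exists f : {additive top_homology K -> 'rV[int]_(num_orderings d n)}, bijective f.
Proof.
rewrite /top_homology max_face /homology.
exact: (quot_eq0_iso boundaries_eq0 comb_values_bij).
Qed.

Lemma admissible_leavesE m : m \in inner_orderings d n ->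
  admissible_leaves n (1%N :: rcons m N) = admissible n m.
Proof.
move=> hm; rewrite /admissible_leaves /admissible.
have sz := size_ordering hm.
have m0 : nth 0%N (1%N :: rcons m N) 1 = head 0%N m.
  by rewrite /= nth_rcons sz /= nth0.
have ml : nth 0%N (1%N :: rcons m N) (size (1%N :: rcons m N) - 2) = last 0%N m.
  have -> : (size (1%N :: rcons m N) - 2 = k.+1)%N by rewrite /= size_rcons sz subn2.
  by rewrite /= nth_rcons sz ltnSn -nth_last sz.
rewrite m0 ml; case: (boolP (marked n (head 0%N m))) => //= hu.
case: (boolP (marked n (last 0%N m))) => //= hl.
case: m hm sz {m0 ml} hu hl => [|a m] // _ _ /= au al.
rewrite rcons_path /color_increasing.
have -> : marked n 1 by rewrite /marked; clear -hn; lia.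
have -> : marked n N = false by rewrite /marked; clear -hd hn; lia.
by rewrite (negPf au) al andbT.
Qed.

Lemma card_admissible_combs : #|admissible_combs d n| = num_orderings d n.
Proof.
rewrite /admissible_combs (eq_in_filter admissible_leavesE) -/admissible_orderings -size_admissible_orderings.
rewrite cardsE -(size_map (comb N)); apply/card_uniqP.
rewrite map_inj_in_uniq ?uniq_admissible_orderings // => m m' /admissible_orderingsP[hm am] /admissible_orderingsP[hm' am'].
exact: comb_inj.
Qed.

End Bicolored.

Theorem theorem4p1 (d n : nat) (hd : 2 <= d) (hn : 2 <= n) :
  (exists f : {additive top_homology (T'' d n) -> 'rV[int]_(num_orderings d n)}, bijective f)
  /\ #|admissible_combs d n| = num_orderings d n.
Proof. by split; [exact: top_homology_iso | exact: card_admissible_combs]. Qed.
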